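(* Consider the sparse additive logistic model $Y\mid(\mathbf X=\mathbf x)\sim B(1,p(\mathbf x))$ with logit $g=\ln\frac{p}{1-p}\in\mathcal G_{\mathcal A}(d_0,\boldsymbol\alpha)$, where $d_0\ln\left(\frac{de}{d_0}\right)\le n$. Then $$\inf_{\widetilde\eta}\ \sup_{\eta^*\in\mathcal C_{\mathcal A}(d_0,\boldsymbol\alpha),\,\mathbb P_X}\mathcal E(\widetilde\eta,\eta^* )\ \ge\ \tilde C\sqrt{\frac{d_0\ln\left(\frac{de}{d_0}\right)}{n}+\sum_{j\in\mathcal J}\frac1{\alpha_j}\,\frac{\ln n}{n}}$$ for some constant $\tilde C>0$, where the infimum is taken over all classifiers $\widetilde\eta$ based on the data $(\mathbf X_1,Y_1),\dots,(\mathbf X_n,Y_n)$.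
   Context: Model. $\mathbf X\in\mathbb R^d$ is a vector of linearly independent features with marginal distribution $\mathbb P_X$ supported on a bounded set $\mathcal X\subseteq[0,1]^d$; $Y\in\{0,1\}$ with $P(Y=1\mid\mathbf X=\mathbf x)=p(\mathbf x)$; the logit is $g(\mathbf x)=\ln\frac{p(\mathbf x)}{1-p(\mathbf x)}\in L_2(\mathcal X)$. The data $D=\{(\mathbf X_i,Y_i)\}_{i=1}^n$ are i.i.d. copies of $(\mathbf X,Y)$. For a classifier $\eta$, the (conditional) misclassification risk is $R(\eta)=P(Y\ne\eta(\mathbf X)\mid D)$. The Bayes classifier is $\eta^*(\mathbf x)=I\{p(\mathbf x)\ge1/2\}=I\{g(\mathbf x)\ge0\}$, and the misclassification excess risk of a data-based classifier $\widetilde\eta$ is $\mathcal E(\widetilde\eta,\eta^* )=\mathbb E R(\widetilde\eta)-R(\eta^* )$, the expectation being over $D$. Function classes. Let $\psi_0=1$, $\psi_\ell(t)=\sqrt2\cos(\pi\ell t)$, $\ell\ge1$, and for a univariate $g_j$ on $[0,1]$ put $\beta_{j\ell}=\int_0^1g_j(t)\psi_\ell(t)\,dt$; because of the identifiability condition $\mathbb E g_j(X_j)=0$ the paper takes $\beta_{j0}=0$. The class of analytic functions is $\mathcal A^{\alpha_j}[0,1]=\{g_j:\sum_{\ell\ge0}e^{2\alpha_j\ell}\beta_{j\ell}^2\le R_j\}$, $\alpha_j>0$, with fixed radius $R_j>0$. For $1\le d_0\le d$, $$\mathcal G_{\mathcal A}(d_0,\boldsymbol\alpha)=\Big\{g\in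 L_2(\mathcal X):\ g(\mathbf x)=\mu+\sum_{j\in\mathcal J}g_j(x_j),\ \mathcal J\subseteq\{1,\dots,d\},\ |\mathcal J|\le d_0,\ g_j\in\mathcal A^{\alpha_j}[0,1],\ \mathbb E g_j(X_j)=0,\ j\in\mathcal J\Big\},$$ where the active set $\mathcal J$ is unknown and ranges over all such subsets, and $\mathcal C_{\mathcal A}(d_0,\boldsymbol\alpha)=\{\eta(\mathbf x)=I\{g(\mathbf x)\ge0\}:g\in\mathcal G_{\mathcal A}(d_0,\boldsymbol\alpha)\}$. The supremum is over true logits $g\in\mathcal G_{\mathcal A}(d_0,\boldsymbol\alpha)$ (with $\eta^*=I\{g\ge0\}$) and over marginal distributions $\mathbb P_X$. Indexing convention: $\boldsymbol\alpha=(\alpha_1,\dots,\alpha_{d_0})$ lists the parameters of the (at most) $d_0$ active components, the active features being enumerated by $1,\dots,d_0$ (some components may vanish); $\sum_{j\in\mathcal J}$ in the bound is the sum over these $d_0$ parameters. Constants. $\tilde C$ is a generic positive constant not depending on $n,d,d_0$.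
   Formalization: As printed it fails (α_j=R_j=1, d=d_0=n: the bound exceeds 1); the formal theorem assumes Σ(1/α_j) ln n ≤ M n for an arbitrary M, α_j in a fixed range [α_min, α_max] with α_min>0, and R_j ≥ R_min>0, and C̃ depends only on these numbers. *)

(* Defs.v *)
From mathcomp Require Export all_boot all_order all_algebra.
From mathcomp Require Export all_classical all_reals all_analysis.
Export Order.TTheory GRing.Theory Num.Theory.
Export numFieldNormedType.Exports.

Set Implicit Arguments.
Unset Strict Implicit.
Unset Printing Implicit Defensive.

Local Open Scope classical_set_scope.
Local Open Scope ring_scope.

Section analytic_class.
Context {R : realType}.

Definition cos_basis (l : nat) (t : R) : R :=
  if l is 0 then 1 else Num.sqrt 2 * cos (pi * l%:R * t).

Definition cos_coef (f : R -> R) (l : nat) : R :=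
  (\int[lebesgue_measure]_(t in `[0, 1]) (f t * cos_basis l t))%R.

(* Cosine coefficients only see [f] up to a Lebesgue-null set, whereas the
   marginal law of a feature may charge such sets.  Continuity selects the
   pointwise (analytic) representative, i.e. the sum of the cosine series. *)
Definition analytic_fun (alpha radius : R) (f : R -> R) : Prop :=
  {within `[0, 1], continuous f} /\
  (\sum_(0 <= l <oo) (expR (2 * alpha * l%:R) * cos_coef f l ^+ 2)%:E
     <= radius%:E)%E.

End analytic_class.

Section model.
Context {R : realType} (d : nat).

Definition cube : set (d.-tuple R) :=
  [set x | forall j, 0 <= tnth x j <= 1].

(* Marginal laws of the features: supported in the unit cube, with no
   nontrivial linear combination of the features vanishing almost surely. *)
Definition feature_law (PX : probability (d.-tuple R) R) : Prop :=
  PX cube = 1%E /\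
  forall c : 'I_d -> R,
    {ae PX, forall x : d.-tuple R, \sum_(j < d) c j * tnth x j = 0} ->
    forall j, c j = 0.

(* [e] enumerates the active features by 'I_d0: the active feature [j] has
   smoothness [alpha (e j)] and radius [radius (e j)]. *)
Definition sparse_additive_analytic (d0 : nat) (alpha radius : 'I_d0 -> R)
    (PX : probability (d.-tuple R) R) (g : d.-tuple R -> R) : Prop :=
  g \in Lfun PX 2%:E /\
  exists (mu : R) (J : {set 'I_d}) (e : 'I_d -> 'I_d0) (gj : 'I_d -> R -> R),
    [/\ (#|J| <= d0)%N,
        {in J &, injective e},
        forall j, j \in J ->
          [/\ analytic_fun (alpha (e j)) (radius (e j)) (gj j),
              cos_coef (gj j) 0 = 0 &
              (\int[PX]_(x in cube) (gj j (tnth x j))%:E = 0)%E] &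
        forall x, cube x -> g x = mu + \sum_(j in J) gj j (tnth x j)].

Definition logit (u : R) : R := ln (u / (1 - u)).

(* [Q] is the law of (X, Y) when X has law [PX] and P(Y = 1 | X = x) = p x. *)
Definition joint_law (PX : probability (d.-tuple R) R) (p : d.-tuple R -> R)
    (Q : probability (d.-tuple R * bool)%type R) : Prop :=
  forall A : set (d.-tuple R), measurable A ->
    Q (A `*` [set true]) = (\int[PX]_(x in A) (p x)%:E)%E /\
    Q (A `*` [set false]) = (\int[PX]_(x in A) (1 - p x)%:E)%E.

(* [Pn] is the law of n i.i.d. copies of a random element of law [Q]. *)
Definition iid_law (n : nat) (Q : probability (d.-tuple R * bool)%type R)
    (Pn : probability (n.-tuple (d.-tuple R * bool)) R) : Prop :=
  forall A : 'I_n -> set (d.-tuple R * bool), (forall i, measurable (A i)) ->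
    Pn [set D | forall i, A i (tnth D i)] = (\prod_(i < n) Q (A i))%E.

Definition risk (Q : probability (d.-tuple R * bool)%type R)
    (eta : d.-tuple R -> bool) : \bar R :=
  Q [set z | z.2 != eta z.1].

Definition bayes (g : d.-tuple R -> R) (x : d.-tuple R) : bool := 0 <= g x.

Definition data_classifier (n : nat)
    (eta : n.-tuple (d.-tuple R * bool) -> d.-tuple R -> bool) : Prop :=
  measurable_fun [set: n.-tuple (d.-tuple R * bool) * d.-tuple R]
    (fun z => eta z.1 z.2).

Definition excess_risk (n : nat) (Q : probability (d.-tuple R * bool)%type R)
    (Pn : probability (n.-tuple (d.-tuple R * bool)) R)
    (eta : n.-tuple (d.-tuple R * bool) -> d.-tuple R -> bool)
    (g : d.-tuple R -> R) : \bar R :=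
  (\int[Pn]_D risk Q (eta D) - risk Q (bayes g))%E.

(* [Q] and [Pn] are determined by [PX] and [p], so this is the set of excess
   risks of [eta] over all true logits in the class and all marginals [PX]. *)
Definition excess_risks (n d0 : nat) (alpha radius : 'I_d0 -> R)
    (eta : n.-tuple (d.-tuple R * bool) -> d.-tuple R -> bool)
    : set (\bar R) :=
  [set r | exists (PX : probability (d.-tuple R) R) (p : d.-tuple R -> R)
                  (Q : probability (d.-tuple R * bool)%type R)
                  (Pn : probability (n.-tuple (d.-tuple R * bool)) R),
     [/\ feature_law PX /\ measurable_fun setT p,
         forall x, cube x -> 0 < p x < 1,
         sparse_additive_analytic alpha radius PX (logit \o p),
         joint_law PX p Q /\ iid_law Q Pn &
         r = excess_risk Q Pn eta (logit \o p)]].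

Definition minimax_excess_risk (n d0 : nat) (alpha radius : 'I_d0 -> R)
    : \bar R :=
  ereal_inf [set ereal_sup (excess_risks alpha radius eta) |
             eta in @data_classifier n].

End model.

(* Main.v *)
From HB Require Import structures.
Require Import Defs.
From mathcomp Require Import measurable_realfun ring lra zify.

(** The rate is the square root of [V / n], where [V] is the number of points
    whose labels the class can prescribe freely with a small margin.  If
    [X] is uniform on [V] points and the logit is [h] or [- h] at each of them
    independently, then [n] observations say almost nothing about most signs as
    soon as [n h^2 <= V], so every classifier errs on a constant fraction of
    the points and its excess risk is of order [h], that is of order
    [sqrt (V / n)].  This is Assouad's lemma ([assouad]), applied to finitely
    supported laws; [minimax_reduction] turns it into a bound on the minimax
    risk.  All active components are odd about 1/2 and the law of the features
    is invariant under the reflection [x |-> 1 - x], so that the components are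
    centred whatever the signs are.

    Two families of points give the two terms of the bound.

    The term [d0 ln (d e / d0)] comes from not knowing the active features
    ([sparse_lower_bound]).  Split [d0 2^B <= d] features into [d0] groups of
    [2^B]; one feature of each group is active, and its component is a multiple
    of [cos (pi t)].  A point that puts 0 or 1 on the features of a group
    according to one binary digit of their rank, and 1/2 elsewhere, reads this
    digit off the active feature.  Together with the sign of the component,
    [B + 1] labels per group can be chosen freely.

    The term [ln n] times the sum of the [1 / alpha] comes from the richness of
    the analytic classes ([hadamard_lower_bound]).  A cosine polynomial of
    degree [L] of order [ln n] interpolates arbitrary values of size [u] at [L]
    nodes with coefficients of size [u], by orthogonality of the discrete
    cosine transform, and membership in the class costs a factor [e^(4 alpha L)],
    a small power of [n].  The margin [h], however, can be of constant order
    when [d0] is close to [n / ln n], and then one component with values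
    [h] or [- h] would be too large.  The remedy is to spread each label
    over [q], between [d0 / 2] and [d0], components by a Hadamard matrix of
    order [q]: a component then takes the value [h / q] times a signed sum of
    [q] labels.  For all but a small proportion of the labellings these sums
    are of order [sqrt q], up to a logarithm ([rademacher_tail]), and the
    components have size [h / sqrt q], which is at most [sqrt (ln n / n)] up to
    logarithms.  The few other labellings are harmless, because the lower bound
    of Assouad holds on average over all labellings. *)

Set Implicit Arguments.
Unset Strict Implicit.
Unset Printing Implicit Defensive.

Local Open Scope classical_set_scope.
Local Open Scope ring_scope.

(** * Finitely supported laws *)

Record pmf (R : realType) (I : finType) := Pmf {
  pmf_fun :> I -> R;
  pmf_ge0 : forall i, 0 <= pmf_fun i;
  pmf_sum1 : \sum_i pmf_fun i = 1 }.

Section finite_law.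
Context d (T : measurableType d) (R : realType) (I : finType).
Variables (w : pmf R I) (f : I -> T).
Local Open Scope ereal_scope.

Definition finite_law (A : set T) : \bar R := \sum_i (w i)%:E * \d_(f i) A.

Let finite_law_msum (i0 : I) : finite_law =
  msum (fun k => mscale (NngNum (pmf_ge0 w (nth i0 (enum I) k)))
                        \d_(f (nth i0 (enum I) k))) #|I|.
Proof.
apply/funext => A; rewrite /finite_law /msum/= /mscale/=.
rewrite -(big_mkord xpredT (fun k => (w (nth i0 (enum I) k))%:E *
   \d_(f (nth i0 (enum I) k)) A)) -big_enum (big_nth i0).
by rewrite -cardE.
Qed.

Let index0 : I.
Proof.
case: (pickP I) => [//|I0]; exfalso; have := pmf_sum1 w.
by rewrite big_pred0 // => /esym/eqP; rewrite oner_eq0.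
Qed.

Let finite_law0 : finite_law set0 = 0.
Proof. by rewrite (finite_law_msum index0) measure0. Qed.

Let finite_law_ge0 A : 0 <= finite_law A.
Proof. by rewrite (finite_law_msum index0). Qed.

Let finite_law_sigma_additive : semi_sigma_additive finite_law.
Proof.
by rewrite (finite_law_msum index0); exact: measure_semi_sigma_additive.
Qed.

HB.instance Definition _ := isMeasure.Build _ _ _ finite_law
  finite_law0 finite_law_ge0 finite_law_sigma_additive.

Let finite_law_setT : finite_law [set: T] = 1.
Proof.
rewrite /finite_law; under eq_bigr do rewrite diracT mule1.
by rewrite sumEFin pmf_sum1.
Qed.

HB.instance Definition _ :=
  @Measure_isProbability.Build _ _ R finite_law finite_law_setT.

Lemma finite_lawE A : finite_law A = (\sum_i w i * \1_A (f i))%:E.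
Proof. by rewrite -sumEFin; apply: eq_bigr => i _; rewrite EFinM. Qed.

Lemma ge0_integral_finite_law (D : set T) (h : T -> \bar R) : measurable D ->
  measurable_fun D h -> (forall x, D x -> 0 <= h x) ->
  \int[finite_law]_(x in D) h x = \sum_i (w i)%:E * (\d_(f i) D * h (f i)).
Proof.
move=> mD mh h0.
rewrite (eq_measure_integral (msum (fun k => mscale (NngNum (pmf_ge0 w (nth index0 (enum I) k)))
                        \d_(f (nth index0 (enum I) k))) #|I|)); last first.
  by move=> A mA _; exact: (congr1 (fun m => m A) (finite_law_msum index0)).
rewrite ge0_integral_measure_sum//.
rewrite -[RHS]big_enum (big_nth index0) -cardE big_mkord.
by apply: eq_bigr => i _; rewrite ge0_integral_mscale// integral_dirac.
Qed.

Lemma integral_finite_law (D : set T) (h : T -> R) : measurable D ->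
  measurable_fun D h ->
  \int[finite_law]_(x in D) (h x)%:E = (\sum_i w i * (\1_D (f i) * h (f i)))%:E.
Proof.
move=> mD /measurable_EFinP mh; rewrite integralE.
rewrite ge0_integral_finite_law//; last exact: measurable_funepos.
rewrite ge0_integral_finite_law//; last exact: measurable_funeneg.
under eq_bigr do rewrite funeposE -EFin_max -!EFinM.
under [X in _ - X]eq_bigr do rewrite funenegE -EFinN -EFin_max -!EFinM.
rewrite !sumEFin -EFinB -sumrB; congr (_%:E); apply: eq_bigr => i _.
rewrite -!mulrBr; congr (_ * (_ * _))%R.
by case: (leP (h (f i)) 0%R) => h0; case: (leP (- h (f i))%R 0%R) => h1; lra.
Qed.

End finite_law.

(** * Assouad's lemma *)

Lemma bernoulli_ineq (R : realType) (x : R) n :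
  0 <= x <= 1 -> 1 - n%:R * (1 - x) <= x ^+ n.
Proof.
move=> /andP[x0 x1]; elim: n => [|n IH]; first by rewrite mul0r subr0 expr0.
have xn1 : x ^+ n <= 1 by rewrite exprn_ile1.
have xn0 : 0 <= x ^+ n by rewrite exprn_ge0.
rewrite exprS -natr1 mulrDl mul1r.
by nra.
Qed.

Lemma sum_prod_ffun (R : realType) (Z : finType) n (F : Z -> R) :
  \sum_(w : {ffun 'I_n -> Z}) \prod_i F (w i) = (\sum_z F z) ^+ n.
Proof.
by rewrite -(bigA_distr_bigA (fun _ z => F z)) prodr_const card_ord.
Qed.

Section two_points.
Context (R : realType) (Z : finType) (P Q : Z -> R).
Hypotheses (P0 : forall z, 0 <= P z) (Q0 : forall z, 0 <= Q z).
Hypotheses (P1 : \sum_z P z = 1) (Q1 : \sum_z Q z = 1).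

(** The geometric mean of [a] and [b] is that of their minimum and maximum;
    weighting these by 4 and 1/4 in the arithmetic-geometric inequality is what
    replaces the Cauchy-Schwarz inequality in [sum_min_ge]. *)
Lemma sqrt_mul_le_min (a b : R) : 0 <= a -> 0 <= b ->
  Num.sqrt (a * b) <= 2 * Num.min a b + (a + b) / 8.
Proof.
move=> a0 b0; wlog ab : a b a0 b0 / a <= b => [H|].
  have [ab|/ltW ba] := leP a b; first by have := H _ _ a0 b0 ab; rewrite (min_idPl ab).
  have := H _ _ b0 a0 ba; rewrite (min_idPl ba) mulrC; lra.
rewrite (min_idPl ab) -[leRHS]ger0_norm; last by nra.
rewrite -sqrtr_sqr ler_wsqrtr//.
by have := sqr_ge0 (2 * a - b / 8); nra.
Qed.

Lemma affinity_le1 : \sum_z Num.sqrt (P z * Q z) <= 1.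
Proof.
have -> : 1 = \sum_z (P z + Q z) / 2 by rewrite -mulr_suml big_split/= P1 Q1; lra.
apply: ler_sum => z _; rewrite -[leRHS]ger0_norm; last first.
  by rewrite divr_ge0// addr_ge0.
rewrite -sqrtr_sqr ler_wsqrtr//.
by have := sqr_ge0 (P z - Q z); nra.
Qed.

(** The affinity is multiplicative, so that of [n] observations is at least 1/2
    by Bernoulli's inequality, and it is at most twice the overlap plus 1/4. *)
Lemma sum_min_ge n :
  n%:R * (1 - \sum_z Num.sqrt (P z * Q z)) <= 1 / 2 ->
  1 / 8 <= \sum_(w : {ffun 'I_n -> Z})
             Num.min (\prod_i P (w i)) (\prod_i Q (w i)).
Proof.
move=> haff.
set rho := \sum_z _ in haff.
have rho01 : 0 <= rho <= 1 by rewrite affinity_le1 sumr_ge0.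
have rhon : rho ^+ n = \sum_(w : {ffun 'I_n -> Z})
    Num.sqrt (\prod_i P (w i) * \prod_i Q (w i)).
  rewrite -sum_prod_ffun; apply: eq_bigr => w _.
  rewrite -big_split/=; elim/big_rec2: _ => [|i x y _ ->]; first by rewrite sqrtr1.
  by rewrite [RHS]sqrtrM// mulr_ge0.
have : rho ^+ n <= 2 * \sum_(w : {ffun 'I_n -> Z})
             Num.min (\prod_i P (w i)) (\prod_i Q (w i)) + 1 / 4.
  have -> : 1 / 4 = \sum_(w : {ffun 'I_n -> Z})
      (\prod_i P (w i) + \prod_i Q (w i)) / 8 :> R.
    by rewrite -mulr_suml big_split/= !sum_prod_ffun P1 Q1 expr1n; lra.
  rewrite rhon mulr_sumr -big_split; apply: ler_sum => w _ /=.
  by apply: sqrt_mul_le_min; apply: prodr_ge0.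
by have := bernoulli_ineq n rho01; lra.
Qed.

End two_points.

Definition flip (V : finType) (v : V) (s : {ffun V -> bool}) : {ffun V -> bool} :=
  [ffun u => (u == v) (+) s u].

Lemma flipK (V : finType) (v : V) : involutive (flip v).
Proof. by move=> s; apply/ffunP => u; rewrite !ffunE addbA addbb. Qed.

(** Pair each labelling with the one that differs from it at [v] only.  For
    each sample the decision at [v] is wrong for one of the two, and the
    overlap of the two laws of the sample is at least 1/8 by [sum_min_ge]. *)
Lemma assouad (R : realType) (V Z : finType) n (P : {ffun V -> bool} -> Z -> R)
    (eta : {ffun 'I_n -> Z} -> V -> bool) :
  (forall s z, 0 <= P s z) -> (forall s, \sum_z P s z = 1) ->
  (forall s v, n%:R * (1 - \sum_z Num.sqrt (P s z * P (flip v s) z)) <= 1 / 2) ->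
  #|V|%:R * #|{ffun V -> bool}|%:R / 16 <=
  \sum_s \sum_(w : {ffun 'I_n -> Z}) (\prod_i P s (w i)) *
     \sum_v (eta w v != s v)%:R.
Proof.
move=> P0 P1 haff.
under eq_bigr do under eq_bigr do rewrite mulr_sumr.
under eq_bigr do rewrite exchange_big/=.
rewrite exchange_big/= -mulrA mulr_natl -sumr_const; apply: ler_sum => v _.
set F := fun s : {ffun V -> bool} => \sum_(w : {ffun 'I_n -> Z})
  (\prod_i P s (w i)) * (eta w v != s v)%:R.
have F2 : 2 * (\sum_s F s) = \sum_s (F s + F (flip v s)).
  rewrite big_split/= mulr_natl mulr2n; congr (_ + _).
  by rewrite (reindex_inj (inv_inj (flipK v))).
suff : #|{ffun V -> bool}|%:R / 8 <= 2 * \sum_s F s.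
  by rewrite -/F; set K := #|{ffun V -> bool}|%:R; lra.
rewrite F2 mulr_natl -sumr_const; apply: ler_sum => s _.
rewrite -div1r; apply: (le_trans (sum_min_ge (P0 s) (P0 (flip v s)) (P1 s) (P1 _) (haff s v))).
rewrite -big_split; apply: ler_sum => w _ /=.
have PP t : 0 <= \prod_(i < n) P t (w i) by apply: prodr_ge0.
rewrite ffunE eqxx/=.
case: (eta w v); case: (s v) => /=; rewrite ?mulr1 ?mulr0 ?add0r ?addr0;
  by rewrite ge_min lexx ?orbT.
Qed.

(** * Cosine coefficients of odd cosine polynomials *)

Section unit_integral.
Context (R : realType).
Implicit Types (f g : R -> R) (c t : R).
Local Notation int01 f := (\int[@lebesgue_measure R]_(t in `[0%R, 1%R]) (f t))%R.

Lemma continuous_integrable01 f : continuous f ->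
  (@lebesgue_measure R).-integrable `[0%R, 1%R] (EFin \o f).
Proof.
move=> cf; apply: continuous_compact_integrable; first exact: segment_compact.
exact: continuous_subspaceT.
Qed.

Lemma cos_basis_continuous l : continuous (@cos_basis R l).
Proof.
case: l => [|l] t /=; first exact: cvg_cst.
apply: cvgM; first exact: cvg_cst.
apply: (@continuous_comp _ _ _ (fun t => pi * l.+1%:R * t) cos).
  by apply: cvgM; [exact: cvg_cst|exact: cvg_id].
exact: continuous_cos.
Qed.

Lemma cos_coefD f g l : continuous f -> continuous g ->
  cos_coef (fun t => f t + g t) l = cos_coef f l + cos_coef g l.
Proof.
move=> cf cg; rewrite /cos_coef -RintegralD//; last 2 first.
- by apply: continuous_integrable01 => t; apply: cvgM; [exact: cf|exact: cos_basis_continuous].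
- by apply: continuous_integrable01 => t; apply: cvgM; [exact: cg|exact: cos_basis_continuous].
by apply: eq_Rintegral => t _; rewrite mulrDl.
Qed.

Lemma cos_coefZ c f l : continuous f ->
  cos_coef (fun t => c * f t) l = c * cos_coef f l.
Proof.
move=> cf; rewrite /cos_coef -RintegralZl//; last first.
  by apply: continuous_integrable01 => t; apply: cvgM; [exact: cf|exact: cos_basis_continuous].
by apply: eq_Rintegral => t _; rewrite mulrA.
Qed.

Lemma sin_pi_nat n : sin (pi * n%:R) = 0 :> R.
Proof.
elim: n => [|n IH]; first by rewrite mulr0 sin0.
by rewrite -natr1 mulrDr mulr1 sinDpi IH oppr0.
Qed.

Lemma integral_cos c : c != 0 -> int01 (fun t => cos (c * t)) = sin c / c.
Proof.
move=> c0; pose F t := c^-1 * sin (c * t).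
have dF t : is_derive t (1:R) F (cos (c * t)).
  rewrite /F; apply: is_derive_eq.
  rewrite /GRing.scale/= !mulr1 ?mulr0 ?addr0 ?add0r; by field.
have cF : continuous F.
  by move=> t; apply: differentiable_continuous; apply/derivable1_diffP; case: (dF t).
rewrite /Rintegral (@continuous_FTC2 _ _ F)//.
- by rewrite /F mulr1 mulr0 sin0 mulr0 -EFinB/= subr0 mulrC.
- apply: continuous_subspaceT => t.
  apply: (@continuous_comp _ _ _ (fun t => c * t) cos).
    by apply: cvgM; [exact: cvg_cst|exact: cvg_id].
  exact: continuous_cos.
- split; first by move=> t _; case: (dF t).
  + exact: cvg_at_right_filter (cF 0).
  + exact: cvg_at_left_filter (cF 1).
- by move=> t _; rewrite derive1E; exact: derive_val.
Qed.

Lemma cos_basis_orthonormal l m : (0 < l)%N ->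
  cos_coef (@cos_basis R l) m = (l == m)%:R.
Proof.
case: l => // l _; rewrite /cos_coef.
have pi0 : pi != 0 :> R by rewrite gt_eqF// pi_gt0.
have cc c : continuous (fun t => cos (c * t)).
  move=> t; apply: (@continuous_comp _ _ _ (fun t => c * t) cos).
    by apply: cvgM; [exact: cvg_cst|exact: cvg_id].
  exact: continuous_cos.
case: m => [|m].
  transitivity (int01 (fun t => Num.sqrt 2 * cos (pi * l.+1%:R * t))).
    by apply: eq_Rintegral => t _; rewrite mulr1.
  rewrite RintegralZl//; last exact: continuous_integrable01.
  rewrite integral_cos; last by rewrite mulf_neq0// pnatr_eq0.
  by rewrite sin_pi_nat mul0r mulr0.
transitivity (int01 (fun t => cos ((pi * l.+1%:R + pi * m.+1%:R) * t) +
                              cos ((pi * l.+1%:R - pi * m.+1%:R) * t))).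
  apply: eq_Rintegral => t _; rewrite /cos_basis [in RHS]mulrDl mulrBl [in RHS]cosD cosB.
  have : Num.sqrt 2 * Num.sqrt 2 = 2 :> R by rewrite -expr2 sqr_sqrtr.
  set x := Num.sqrt 2; set a := cos _; set b := cos _ => xx.
  transitivity ((x * x) * a * b); first by ring.
  by rewrite xx; ring.
rewrite RintegralD//; try exact: continuous_integrable01.
rewrite integral_cos; last first.
  by rewrite -mulrDr mulf_neq0// -natrD pnatr_eq0.
rewrite -mulrDr -natrD sin_pi_nat mul0r add0r.
rewrite eqSS; have [->|lm] := eqVneq l m.
  transitivity (int01 (fun=> 1)).
    by apply: eq_Rintegral => t _; rewrite subrr mul0r cos0.
  have := lebesgue_measure_itv (`[0, 1] : interval R).
  rewrite /= lte_fin ltr01 oppr0 adde0 => e.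
  by rewrite Rintegral_cst// mul1r; exact: (congr1 fine e).
rewrite integral_cos; last by rewrite -mulrBr mulf_neq0// subr_eq0 eqr_nat eqSS.
by rewrite sinB !sin_pi_nat mul0r mulr0 subrr mul0r.
Qed.

End unit_integral.

Section odd_cosine_polynomials.
Context (R : realType) (L : nat).
Implicit Types (b : 'I_L -> R) (t : R).

(** Only odd frequencies occur, since [cos (pi m t)] is odd about 1/2 exactly
    for [m] odd. *)
Definition odd_cos_poly b t : R := \sum_(l < L) b l * cos_basis l.*2.+1 t.

Lemma odd_cos_poly_reflect b t : odd_cos_poly b (1 - t) = - odd_cos_poly b t.
Proof.
rewrite /odd_cos_poly -sumrN; apply: eq_bigr => l _.
rewrite -mulrN /cos_basis -mulrN; congr (_ * (_ * _)).
rewrite mulrBr mulr1 cosB sin_pi_nat mul0r addr0.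
have -> : cos (pi * l.*2.+1%:R) = -1 :> R.
  elim: (nat_of_ord l) => [|k IH]; first by rewrite mulr1 cospi.
  have -> : pi * k.+1.*2.+1%:R = pi * k.*2.+1%:R + pi + pi :> R.
    by rewrite doubleS -!natr1; ring.
  by rewrite !cosDpi IH opprK.
by rewrite mulN1r.
Qed.

Lemma odd_cos_poly_continuous b : continuous (odd_cos_poly b).
Proof.
have -> : odd_cos_poly b = \sum_(l < L) (fun t => b l * cos_basis l.*2.+1 t).
  by apply/funext => t; rewrite fct_sumE.
elim/big_ind: _ => [|f g cf cg|l _].
- by move=> t; exact: cvg_cst.
- by move=> t; apply: cvgD; [exact: cf|exact: cg].
- by move=> t; apply: cvgM; [exact: cvg_cst|exact: cos_basis_continuous].
Qed.

Lemma cos_coef_odd_cos_poly b m :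
  cos_coef (odd_cos_poly b) m = \sum_(l < L) b l * (l.*2.+1 == m)%:R.
Proof.
have -> : odd_cos_poly b = \sum_(l < L) (fun t => b l * cos_basis l.*2.+1 t).
  by apply/funext => t; rewrite fct_sumE.
suff [] : cos_coef (\sum_(l < L) (fun t => b l * cos_basis l.*2.+1 t)) m =
  \sum_(l < L) b l * (l.*2.+1 == m)%:R /\
  continuous (\sum_(l < L) (fun t => b l * cos_basis l.*2.+1 t)) by [].
elim/big_rec2: _ => [|l x f _ [IH cf]].
  split; last by move=> t; exact: cvg_cst.
  rewrite /cos_coef; under eq_Rintegral do rewrite mul0r.
  by rewrite Rintegral_cst// mul0r.
have cb : continuous (fun t => b l * cos_basis l.*2.+1 t).
  by move=> t; apply: cvgM; [exact: cvg_cst|exact: cos_basis_continuous].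
split; last by move=> t; apply: cvgD; [exact: cb|exact: cf].
rewrite cos_coefD// IH cos_coefZ; last exact: cos_basis_continuous.
by rewrite cos_basis_orthonormal.
Qed.

Lemma cos_coef_odd_cos_poly_odd b (l : 'I_L) :
  cos_coef (odd_cos_poly b) l.*2.+1 = b l.
Proof.
rewrite cos_coef_odd_cos_poly (bigD1 l)//= eqxx mulr1 big1 ?addr0// => k kl.
by rewrite eqSS -!muln2 eqn_mul2r/= (inj_eq val_inj) (negbTE kl) mulr0.
Qed.

Lemma cos_coef_odd_cos_poly0 b : cos_coef (odd_cos_poly b) 0 = 0.
Proof. by rewrite cos_coef_odd_cos_poly big1// => l _; rewrite mulr0. Qed.

(** The series that defines the class is finite for a cosine polynomial. *)
Lemma analytic_odd_cos_poly alpha radius b :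
  \sum_(l < L) expR (2 * alpha * l.*2.+1%:R) * b l ^+ 2 <= radius ->
  analytic_fun alpha radius (odd_cos_poly b).
Proof.
move=> hb; split.
  by apply: continuous_subspaceT; exact: odd_cos_poly_continuous.
pose F m := expR (2 * alpha * m%:R) * cos_coef (odd_cos_poly b) m ^+ 2.
have F0 m : 0 <= F m by rewrite mulr_ge0 ?expR_ge0 ?sqr_ge0.
have Fout m : (forall l : 'I_L, l.*2.+1 != m) -> F m = 0.
  move=> hm; rewrite /F cos_coef_odd_cos_poly big1 ?expr0n/= ?mulr0// => l _.
  by rewrite (negbTE (hm l)) mulr0.
have Feven l : F l.*2 = 0.
  by apply: Fout => k; apply/eqP => /(congr1 odd); rewrite /= !odd_double.
have Fodd (k : nat) : \sum_(0 <= m < k.*2.+1) F m = \sum_(0 <= l < k) F l.*2.+1.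
  elim: k => [|k IH]; first by rewrite big_nat1 big_geq// (Feven 0).
  rewrite doubleS big_nat_recr//= big_nat_recr//= IH [RHS]big_nat_recr//=.
  by rewrite -doubleS Feven addr0.
rewrite (nneseries_split 0 L.*2.+1)//; last by move=> m _; rewrite lee_fin; exact: F0.
rewrite [X in (_ + X)%E]eseries0 ?adde0; last first.
  move=> m Lm _; rewrite -/(F m) Fout// => l; rewrite neq_ltn; apply/orP; left.
  by apply: leq_trans Lm; rewrite add0n ltnS ltn_double.
rewrite add0n sumEFin lee_fin; apply: le_trans hb.
rewrite Fodd big_mkord; apply: ler_sum => l _.
by rewrite /F cos_coef_odd_cos_poly_odd.
Qed.

End odd_cosine_polynomials.

(** * Interpolation by the discrete cosine transform *)

Section discrete_cosine_transform.
Context (R : realType) (L : nat).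
Hypothesis L0 : (0 < L)%N.

Definition dct_node (k : nat) : R := k.*2.+1%:R / (4 * L%:R).

Let L_gt0 : 0 < L%:R :> R. Proof. by rewrite ltr0n. Qed.

Lemma dct_node_itv k : (k < L)%N -> 0 <= dct_node k <= 1.
Proof.
move=> kL; rewrite divr_ge0 ?mulr_ge0 ?ler0n//=.
rewrite ler_pdivrMr ?mulr_gt0// mul1r.
have -> : 4 * L%:R = (4 * L)%:R :> R by rewrite natrM.
by rewrite ler_nat; move: kL; lia.
Qed.

(** Multiplication by [2 sin x] makes the sum telescope. *)
Lemma sum_cos_odd (n : nat) (x : R) :
  2 * sin x * \sum_(l < n) cos (l.*2.+1%:R * x) = sin (n.*2%:R * x).
Proof.
elim: n => [|n IH]; first by rewrite big_ord0 mulr0 mul0r sin0.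
rewrite big_ord_recr/= mulrDr IH doubleS.
have -> : n.*2.+2%:R * x = n.*2.+1%:R * x + x by rewrite -natr1 mulrDl mul1r.
have -> : n.*2%:R * x = n.*2.+1%:R * x - x by rewrite -[n.*2.+1%:R]natr1 mulrDl mul1r addrK.
by rewrite sinB sinD; ring.
Qed.

Lemma sum_cos_odd_eq0 (m : nat) : (0 < m < L.*2)%N ->
  \sum_(l < L) cos (l.*2.+1%:R * (pi * m%:R / L.*2%:R)) = 0 :> R.
Proof.
move=> /andP[m0 mL]; set x := pi * m%:R / L.*2%:R.
have LL : 0 < L.*2%:R :> R by rewrite ltr0n double_gt0.
have s0 : 0 < sin x.
  rewrite sin_gt0_pi// divr_gt0 ?mulr_gt0 ?pi_gt0 ?LL ?ltr0n//=.
  by rewrite ltr_pdivrMr// ltr_pM2l ?pi_gt0// ltr_nat.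
have xE : L.*2%:R * x = pi * m%:R by rewrite mulrC divfK// gt_eqF.
have := sum_cos_odd L x; rewrite xE.
by rewrite sin_pi_nat => /eqP; rewrite !mulf_eq0 pnatr_eq0 (gt_eqF s0)/= => /eqP.
Qed.

(** Orthogonality of the discrete cosine transform of type IV: the product of
    two cosines is a sum of two, and both resulting arithmetic sums telescope
    by [sum_cos_odd], except for the difference when [k = k']. *)
Lemma dct_orthogonal (k k' : 'I_L) :
  \sum_(l < L) cos (pi * l.*2.+1%:R * dct_node k) *
               cos (pi * l.*2.+1%:R * dct_node k') = (L%:R / 2) * (k == k')%:R.
Proof.
wlog kk : k k' / (k' <= k)%N => [H|].
  have [|/ltnW kk] := leqP k' k; first exact: H.
  by rewrite eq_sym -H//; apply: eq_bigr => l _; rewrite mulrC.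
have L2 : L.*2%:R = 2 * L%:R :> R by rewrite -mul2n natrM.
have node j : dct_node j = (2 * j%:R + 1) / (4 * L%:R).
  by rewrite /dct_node -natr1 -mul2n natrM.
have LN : L%:R != 0 :> R by rewrite gt_eqF.
transitivity (\sum_(l < L)
   (cos (l.*2.+1%:R * (pi * (k + k').+1%:R / L.*2%:R)) +
    cos (l.*2.+1%:R * (pi * (k - k')%N%:R / L.*2%:R))) / 2 : R).
  apply: eq_bigr => l _.
  have -> : l.*2.+1%:R * (pi * (k + k').+1%:R / L.*2%:R) =
     pi * l.*2.+1%:R * dct_node k + pi * l.*2.+1%:R * dct_node k' :> R.
    by rewrite !node L2 -[(_ + _).+1%:R]natr1 natrD; field.
  have -> : l.*2.+1%:R * (pi * (k - k')%N%:R / L.*2%:R) =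
     pi * l.*2.+1%:R * dct_node k - pi * l.*2.+1%:R * dct_node k' :> R.
    by rewrite !node L2 natrB//; field.
  by rewrite cosD cosB; field.
rewrite -mulr_suml big_split/= sum_cos_odd_eq0; last first.
  by have := ltn_ord k; have := ltn_ord k'; lia.
rewrite add0r; have [->|kneq] := eqVneq k k'.
  rewrite subnn; under eq_bigr do rewrite mulr0 mul0r mulr0 cos0.
  by rewrite sumr_const card_ord mulr1.
rewrite sum_cos_odd_eq0 ?mul0r ?mulr0//.
have := ltn_ord k; have : (k != k' :> nat) by [].
by lia.
Qed.

(** The bound on the coefficients does not depend on the number of nodes: the
    transform is its own inverse up to the factor [2 / L]. *)
Lemma odd_cos_poly_interpolation (u : 'I_L -> R) (M : R) :
  (forall k, `|u k| <= M) ->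
  exists b : 'I_L -> R,
    (forall k : 'I_L, odd_cos_poly b (dct_node k) = u k) /\
    (forall l, `|b l| <= 2 * M).
Proof.
move=> uM.
have LN : L%:R != 0 :> R by rewrite gt_eqF.
have s2 : Num.sqrt 2 * Num.sqrt 2 = 2 :> R by rewrite -expr2 sqr_sqrtr.
have s0 : 0 <= Num.sqrt 2 :> R by exact: sqrtr_ge0.
exists (fun l => Num.sqrt 2 / L%:R *
   \sum_k u k * cos (pi * l.*2.+1%:R * dct_node k)); split => [k|l].
  rewrite /odd_cos_poly.
  transitivity (2 / L%:R * \sum_(l < L) \sum_(j < L) u j *
    (cos (pi * l.*2.+1%:R * dct_node j) * cos (pi * l.*2.+1%:R * dct_node k))).
    rewrite mulr_sumr; apply: eq_bigr => l _ /=.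
    rewrite !mulr_sumr mulr_suml; apply: eq_bigr => j _.
    by rewrite -[in RHS]s2; ring.
  rewrite exchange_big/=.
  under eq_bigr do rewrite -mulr_sumr dct_orthogonal.
  rewrite (bigD1 k)//= eqxx big1 => [|j jk]; last by rewrite (negbTE jk) !mulr0.
  by rewrite mulr1 addr0; field.
have M0 : 0 <= M by apply: le_trans (uM l).
rewrite normrM normf_div [`|Num.sqrt 2|]ger0_norm// [`|L%:R|]gtr0_norm//.
have : `|\sum_(k < L) u k * cos (pi * l.*2.+1%:R * dct_node k)| <= L%:R * M.
  apply: (le_trans (ler_norm_sum _ _ _)).
  rewrite -[in leRHS](card_ord L) mulr_natl -sumr_const; apply: ler_sum => k _.
  by rewrite normrM -[leRHS]mulr1 ler_pM ?cos_max.
move=> h; apply: (@le_trans _ _ (Num.sqrt 2 / L%:R * (L%:R * M))).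
  by rewrite ler_wpM2l// divr_ge0// ltW.
rewrite mulrA divfK// ler_wpM2r//.
by nra.
Qed.

End discrete_cosine_transform.

(** * Lower bound on a finite design *)

Lemma sum_pair (R : realType) (A B : finType) (F : A * B -> R) :
  \sum_z F z = \sum_a \sum_b F (a, b).
Proof. by rewrite pair_bigA; apply: eq_bigr => -[]. Qed.

Section labelled.
Context (R : realType) (W : finType) (w : pmf R W) (p : W -> R).
Hypothesis p01 : forall z, 0 <= p z <= 1.

Definition label_weight (z : W * bool) : R :=
  w z.1 * (if z.2 then p z.1 else 1 - p z.1).

Lemma label_weight_ge0 z : 0 <= label_weight z.
Proof.
have /andP[p0 p1] := p01 z.1.
by rewrite mulr_ge0 ?pmf_ge0//; case: ifP; rewrite ?subr_ge0.
Qed.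

Lemma sum_label_weight (F : W -> bool -> R) :
  \sum_z label_weight z * F z.1 z.2 =
  \sum_z w z * (p z * F z true + (1 - p z) * F z false).
Proof.
rewrite sum_pair.
by apply: eq_bigr => z _; rewrite big_bool /label_weight/=; ring.
Qed.

Lemma label_weight_sum1 : \sum_z label_weight z = 1.
Proof.
rewrite -(pmf_sum1 w); under eq_bigr do rewrite -[label_weight _]mulr1.
rewrite (sum_label_weight (fun _ _ => 1)).
by apply: eq_bigr => z _; ring.
Qed.

Definition label_pmf : pmf R (W * bool)%type :=
  Pmf label_weight_ge0 label_weight_sum1.
End labelled.

Section product.
Context (R : realType) (Z : finType) (n : nat) (q : pmf R Z).

Definition prod_weight (w : {ffun 'I_n -> Z}) : R := \prod_i q (w i).

Lemma prod_weight_ge0 w : 0 <= prod_weight w.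
Proof. by apply: prodr_ge0 => i _; exact: pmf_ge0. Qed.

Lemma prod_weight_sum1 : \sum_w prod_weight w = 1.
Proof. by rewrite sum_prod_ffun pmf_sum1 expr1n. Qed.

Definition prod_pmf : pmf R {ffun 'I_n -> Z} :=
  Pmf prod_weight_ge0 prod_weight_sum1.
End product.

Section contaminated_uniform.
Context (R : realType) (V I : finType) (eps : R).
Hypotheses (V0 : (0 < #|V|)%N) (I0 : (0 < #|I|)%N) (eps01 : 0 <= eps <= 1).

(** Uniform on the design points indexed by [V], which carry the lower bound,
    up to a mass [eps] on points indexed by [I], which will make the features
    linearly independent.  The boolean stands for a point or its reflection. *)
Definition design_weight (z : (V + I) * bool) : R :=
  match z.1 with
  | inl _ => (1 - eps) / (2 * #|V|%:R)
  | inr _ => eps / (2 * #|I|%:R)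
  end.

Lemma design_weight_ge0 z : 0 <= design_weight z.
Proof.
by case/andP: eps01 => e0 e1; case: z => -[v|i] s /=;
  rewrite /design_weight/= divr_ge0 ?mulr_ge0 ?subr_ge0.
Qed.

Lemma sum_design (F : (V + I) * bool -> R) :
  \sum_z F z = \sum_v (F (inl v, true) + F (inl v, false)) +
               \sum_i (F (inr i, true) + F (inr i, false)).
Proof.
rewrite sum_pair big_sumType/=.
by congr (_ + _); apply: eq_bigr => z _; rewrite big_bool.
Qed.

Lemma design_weight_sum1 : \sum_z design_weight z = 1.
Proof.
rewrite sum_design /design_weight/= !sumr_const -[X in X + _]mulr_natl -[X in _ + X]mulr_natl.
have V1 : #|V|%:R != 0 :> R by rewrite pnatr_eq0 -lt0n.
have I1 : #|I|%:R != 0 :> R by rewrite pnatr_eq0 -lt0n.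
by field; apply/andP; split; first [exact: V1|exact: I1].
Qed.

Definition design_pmf : pmf R ((V + I) * bool)%type :=
  Pmf design_weight_ge0 design_weight_sum1.

End contaminated_uniform.

Section finite_lower_bound.
Context (R : realType) (V I : finType) (n : nat) (delta : R).
Context (p : {ffun V -> bool} -> (V + I) * bool -> R).
Hypotheses (V0 : (0 < #|V|)%N) (I0 : (0 < #|I|)%N) (n0 : (0 < n)%N).
Hypothesis delta01 : 0 <= delta <= 1 / 2.
Hypothesis delta_small : 16 * n%:R * delta ^+ 2 <= #|V|%:R.
Hypothesis p01 : forall s z, 0 <= p s z <= 1.
Hypothesis p_inl : forall s v c,
  p s (inl v, c) = 1 / 2 + (if s v (+) c then delta else - delta).

Let eps : R := (4 * n%:R)^-1.
Let nR : 0 < n%:R :> R. Proof. by rewrite ltr0n. Qed.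
Let n1 : 1 <= n%:R :> R. Proof. by rewrite ler1n. Qed.
Let neps : n%:R * eps = 1 / 4.
Proof. by rewrite /eps; field; rewrite gt_eqF. Qed.
Lemma contamination01 : 0 <= (4 * n%:R : R)^-1 <= 1.
Proof.
rewrite invr_ge0 mulr_ge0//= invf_le1 ?mulr_gt0//.
by have := n1; lra.
Qed.

Let w := design_pmf V0 I0 contamination01.
Let q s := label_pmf w (p01 s).
Let VR : 0 < #|V|%:R :> R. Proof. by rewrite ltr0n. Qed.

(** The two labellings differ on an event of probability [(1 - eps) / #|V|],
    where the loss of affinity is of order [delta ^+ 2].  The labels of
    the points of total mass [eps] may vary with [s] in any way: their affinity
    is bounded below by 0, which costs [n * eps = 1 / 4]. *)
Lemma design_affinity (s : {ffun V -> bool}) (v : V) :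
  n%:R * (1 - \sum_z Num.sqrt (q s z * q (flip v s) z)) <= 1 / 2.
Proof.
have /andP[d0 d1] := delta01.
have dd : delta ^+ 2 <= 1 / 4.
  have d1' : 0 <= 1 / 2 - delta by lra.
  by have := mulr_ge0 d0 d1'; lra.
have d4 : 0 <= (delta ^+ 2) ^+ 2 by rewrite sqr_ge0.
pose a := (1 - eps) / (2 * #|V|%:R).
have a0 : 0 <= a by rewrite divr_ge0 ?mulr_ge0// subr_ge0; case/andP: contamination01.
have E : 1 - eps - 8 * a * delta ^+ 2 <= \sum_z Num.sqrt (q s z * q (flip v s) z).
  rewrite sum_pair sum_design.
  rewrite -[leLHS]addr0; apply: lerD; last first.
    by apply: sumr_ge0 => i _; rewrite addr_ge0// sumr_ge0.
  have sq (y : R) : 0 <= y -> Num.sqrt (y * y) = y by move=> y0; rewrite -expr2 sqrtr_sqr ger0_norm.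
  have av : \sum_(u in V) (2 * a) = 1 - eps.
    by rewrite sumr_const -[X in X = _]mulr_natl /a; field; rewrite gt_eqF.
  rewrite -av (bigD1 v)//= [leRHS](bigD1 v)//= addrAC; apply: lerD; last first.
    apply: ler_sum => u uv; rewrite !big_bool /label_weight/= !p_inl !ffunE (negbTE uv)/=.
    rewrite /design_weight/= -/eps -/a.
    by case: (s u) => /=; rewrite !sq; try lra; apply: mulr_ge0; lra.
  rewrite !big_bool /label_weight/= !p_inl !ffunE eqxx/= /design_weight/= -/eps -/a.
  have H (x y : R) : x * y = a ^+ 2 * (1 / 4 - delta ^+ 2) ->
      a * (1 / 2 - 2 * delta ^+ 2) <= Num.sqrt (x * y).
    move=> ->; rewrite -[leLHS]ger0_norm; last by rewrite mulr_ge0//; lra.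
    rewrite -sqrtr_sqr ler_wsqrtr// exprMn ler_wpM2l ?sqr_ge0//.
    have -> : (1 / 2 - 2 * delta ^+ 2) ^+ 2 = 1 / 4 - 2 * delta ^+ 2 + 4 * (delta ^+ 2) ^+ 2 by field.
    have := mulr_ge0 (sqr_ge0 delta) (_ : 0 <= 1 / 4 - delta ^+ 2); lra.
  have := H (a * (1 / 2 + (if s v (+) true then delta else - delta))) (a * (1 / 2 + (if ~~ s v (+) true then delta else - delta))).
  have := H (a * (1 - (1 / 2 + (if s v (+) true then delta else - delta)))) (a * (1 - (1 / 2 + (if ~~ s v (+) true then delta else - delta)))).
  have := H (a * (1 / 2 + (if s v (+) false then delta else - delta))) (a * (1 / 2 + (if ~~ s v (+) false then delta else - delta))).
  have := H (a * (1 - (1 / 2 + (if s v (+) false then delta else - delta)))) (a * (1 - (1 / 2 + (if ~~ s v (+) false then delta else - delta)))).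
  by case: (s v) => /=; do 4 (move=> /(_ ltac:(field))); lra.
have ha : a * #|V|%:R <= 1 / 2.
  rewrite /a invfM mulrA divfK ?gt_eqF//.
  by have /andP[] := contamination01; rewrite -/eps; lra.
have h8 : 8 * n%:R * (a * delta ^+ 2) <= 1 / 4.
  have : a * (16 * n%:R * delta ^+ 2) <= a * #|V|%:R by rewrite ler_wpM2l.
  by lra.
have := ler_wpM2l (ltW nR) E; rewrite mulrBr mulrBr neps.
by lra.
Qed.

(** Assouad's bound is an average over all labellings.  The risk being at most
    1, removing a proportion 1/64 of the labellings leaves one with risk at
    least 1/64: the average is at least [(1 - eps) / 16], hence at least
    3/64. *)
Lemma finite_lower_bound (good : pred {ffun V -> bool})
    (eta : {ffun 'I_n -> ((V + I) * bool) * bool} -> V -> bool -> bool) :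
  64 * #|[pred s | ~~ good s]|%:R <= #|{ffun V -> bool}|%:R :> R ->
  exists2 s, good s &
    1 / 64 <= \sum_o prod_weight (q s) o *
       \sum_v \sum_(c : bool) w (inl v, c) * (eta o v c != s v (+) c)%:R.
Proof.
move=> hbad.
set K : R := #|{ffun V -> bool}|%:R in hbad *.
have K0 : 0 < K by rewrite ltr0n; apply/card_gt0P; exists [ffun=> true].
pose risk s := \sum_o prod_weight (q s) o *
       \sum_v \sum_(c : bool) w (inl v, c) * (eta o v c != s v (+) c)%:R.
have wE v c : w (inl v, c) = (1 - eps) / (2 * #|V|%:R) by [].
have e01 : 0 <= eps <= 1 / 4.
  by have /andP[e0 _] := contamination01; rewrite -/eps in e0; rewrite e0/=; have := neps; have := n1; nra.
have w0 : 0 <= (1 - eps) / (2 * #|V|%:R) by rewrite divr_ge0 ?mulr_ge0//; lra.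
have risk_le1 s : risk s <= 1.
  rewrite -(prod_weight_sum1 n (q s)); apply: ler_sum => o _.
  rewrite -[leRHS]mulr1 ler_wpM2l ?prod_weight_ge0//.
  apply: (@le_trans _ _ (\sum_(v : V) \sum_(c : bool) (1 - eps) / (2 * #|V|%:R))).
    apply: ler_sum => v _; apply: ler_sum => c _.
    by rewrite wE; case: (_ != _); rewrite ?mulr1 ?mulr0.
  under eq_bigr do rewrite big_bool/=.
  rewrite sumr_const -[X in X <= _]mulr_natl.
  have -> : #|V|%:R * ((1 - eps) / (2 * #|V|%:R) + (1 - eps) / (2 * #|V|%:R)) = 1 - eps.
    by field; rewrite gt_eqF.
  by lra.
have total : (1 - eps) * K / 16 <= \sum_s risk s.
  have A c := assouad (P := fun s => q s) (fun o v => eta o v c (+) c)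
     (fun s => pmf_ge0 (q s)) (fun s => pmf_sum1 (q s)) design_affinity.
  have -> : \sum_s risk s = (1 - eps) / (2 * #|V|%:R) * \sum_(c : bool)
     \sum_s \sum_(o : {ffun 'I_n -> ((V + I) * bool) * bool})
       (\prod_i q s (o i)) * \sum_v (eta o v c (+) c != s v)%:R.
    rewrite big_bool/= -big_split mulr_sumr; apply: eq_bigr => s _ /=.
    rewrite -big_split mulr_sumr; apply: eq_bigr => o _ /=.
    rewrite /prod_weight -mulrDr -big_split/= mulrCA; congr (_ * _).
    rewrite mulr_sumr; apply: eq_bigr => v _.
    rewrite big_bool /= /design_weight /= -/eps -mulrDr; congr (_ * (_ %:R + _%:R)).
    - by case: (eta _ _ _); case: (s v).
    - by case: (eta _ _ _); case: (s v).
  rewrite big_bool/=.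
  have := lerD (A true) (A false); rewrite -/K => {}A.
  have := ler_wpM2l w0 A; apply: le_trans.
  have -> : (1 - eps) / (2 * #|V|%:R) * (#|V|%:R * K / 16 + #|V|%:R * K / 16) =
    (1 - eps) * K / 16 by field; rewrite gt_eqF.
  by [].
case: (boolP [exists s, good s && (1 / 64 <= risk s)]) => [/existsP[s /andP[gs rs]]|].
  by exists s.
rewrite negb_exists => /forallP H; exfalso.
have : \sum_s risk s <= \sum_s (1 / 64 * 1 + (~~ good s)%:R).
  apply: ler_sum => s _; have := H s; rewrite negb_and -ltNge.
  by have := risk_le1 s; case: (good s) => /=; lra.
rewrite big_split/= mulr1 sumr_const -[X in _ <= X + _]mulr_natl -/K.
have -> : \sum_s (~~ good s)%:R = #|[pred s | ~~ good s]|%:R :> R.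
  rewrite -sum1_card natr_sum [RHS]big_mkcond/=; apply: eq_bigr => s _.
  by rewrite inE; case: (good s).
have : (1 - eps) * K >= 3 / 4 * K by rewrite ler_wpM2r ?(ltW K0)//; case/andP: e01 => _ e1; lra.
by set B : R := #|_|%:R in hbad *; lra.
Qed.

End finite_lower_bound.

(** * The classification model with finitely supported features *)

Lemma Lfun_finite_law d (T : measurableType d) (R : realType) (I : finType)
    (w : pmf R I) (f : I -> T) (h : T -> R) (r : R) :
  measurable_fun setT h -> h \in Lfun (finite_law w f) r%:E.
Proof.
move=> mh; rewrite inE; apply/andP; split; first by rewrite inE.
rewrite inE/= /finite_norm unlock /Lnorm/=.
have mhr : measurable_fun setT (fun x => `|h x| `^ r).
  have mn : measurable_fun setT (fun x => `|h x|) by exact: measurableT_comp.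
  exact: (measurableT_comp (measurable_powR r) mn).
by rewrite (integral_finite_law w f measurableT mhr) poweR_EFin ltry.
Qed.

Section finite_model.
Context (R : realType) (d : nat) (W : finType) (w : pmf R W).
Context (f : W -> d.-tuple R) (p : d.-tuple R -> R).
Hypotheses (mp : measurable_fun setT p) (p01 : forall x, 0 <= p x <= 1).

Let q := label_pmf w (fun z => p01 (f z)).

Definition labelled_point (z : W * bool) : d.-tuple R * bool := (f z.1, z.2).

Let Q : probability (d.-tuple R * bool)%type R := finite_law q labelled_point.

Lemma joint_law_finite : joint_law (finite_law w f) p Q.
Proof.
have mp1 : measurable_fun setT (fun x => 1 - p x) by exact: measurable_funB.
move=> A mA; rewrite !integral_finite_law//; try exact: measurable_funTS.
rewrite /Q/= !finite_lawE.
have E (y : bool) : \sum_i q i * \1_(A `*` [set y]) (labelled_point i) =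
    \sum_z w z * (if y then \1_A (f z) * p (f z) else \1_A (f z) * (1 - p (f z))).
  rewrite (sum_label_weight w (fun z => p (f z)) (fun z c => \1_(A `*` [set y]) (f z, c))).
  apply: eq_bigr => z _; congr (_ * _).
  have e c : \1_(A `*` [set y]) (f z, c) = \1_A (f z) * (c == y)%:R :> R.
    rewrite !indicE in_setX/= -natrM mulnb; congr (_ && _)%:R.
    by apply/idP/eqP => [/set_mem|->]//; apply/mem_set.
  by rewrite !e; case: y {e} => /=; rewrite !mulr1 !mulr0 ?addr0 ?add0r mulrC.
by rewrite !E.
Qed.

Context (n : nat).

Definition sample (o : {ffun 'I_n -> W * bool}) : n.-tuple (d.-tuple R * bool) :=
  [tuple labelled_point (o i) | i < n].

Let Pn : probability (n.-tuple (d.-tuple R * bool)) R :=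
  finite_law (prod_pmf n q) sample.

Lemma iid_law_finite : iid_law Q Pn.
Proof.
move=> A mA; rewrite /Q /Pn/= finite_lawE.
under eq_bigr do rewrite finite_lawE.
rewrite prodEFin; congr (_%:E).
rewrite bigA_distr_bigA/=; apply: eq_bigr => o _.
rewrite [in RHS]big_split/=; congr (_ * _).
rewrite indicE; case: (boolP (_ \in _)) => [/set_mem/= h|h].
  rewrite big1// => i _; rewrite indicE mem_set//.
  by have := h i; rewrite tnth_mktuple.
have [i hi] : exists i, ~ A i (labelled_point (o i)).
  apply: contrapT => H; move/negP: h; apply; apply: mem_set => i /=.
  by rewrite tnth_mktuple; apply: contrapT => Hi; apply: H; exists i.
by rewrite (bigD1 i)//= indicE memNset// mul0r.
Qed.

Definition finite_risk (e : d.-tuple R -> bool) : R :=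
  \sum_z w z * (if e (f z) then 1 - p (f z) else p (f z)).

Lemma risk_finite (e : d.-tuple R -> bool) : risk Q e = (finite_risk e)%:E.
Proof.
rewrite /risk /Q/= finite_lawE; congr (_%:E).
rewrite (sum_label_weight w (fun z => p (f z)) (fun z c => \1_[set z | z.2 != e z.1] (f z, c))).
apply: eq_bigr => z _; congr (_ * _); rewrite !indicE.
have E c : ((f z, c) \in [set z : d.-tuple R * bool | z.2 != e z.1]) = (c != e (f z)).
  by apply/idP/idP => [/set_mem//|h]; apply: mem_set.
by rewrite !E; case: (e _) => /=; rewrite ?mulr0 ?mulr1 ?addr0 ?add0r.
Qed.

Lemma excess_risk_finite (eta : n.-tuple (d.-tuple R * bool) -> d.-tuple R -> bool)
    (g : d.-tuple R -> R) : data_classifier eta ->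
  excess_risk Q Pn eta g =
  (\sum_o prod_weight q o * (finite_risk (eta (sample o)) - finite_risk (bayes g)))%:E.
Proof.
move=> meta; rewrite /excess_risk.
under eq_integral do rewrite risk_finite.
rewrite risk_finite /Pn/= integral_finite_law//; last first.
  apply: measurable_sum => z; apply: measurable_funM; first exact: measurable_cst.
  apply: measurable_fun_ifT; try exact: measurable_cst.
  have := measurableT_comp meta (pair2_measurable (f z)); exact.
rewrite -EFinB; congr (_%:E).
under [in RHS]eq_bigr do rewrite mulrBr.
rewrite sumrB -mulr_suml prod_weight_sum1 mul1r; congr (_ - _).
by apply: eq_bigr => o _; rewrite indicT mul1r.
Qed.

End finite_model.

(** * From freely prescribed labels to the minimax risk *)

Section sigmoid.
Context (R : realType).
Implicit Types u h : R.

Definition sigmoid u : R := (1 + expR (- u))^-1.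

Lemma sigmoid01 u : 0 < sigmoid u < 1.
Proof.
have := expR_gt0 (- u) => e0; have e1 : 0 < 1 + expR (- u) by lra.
by rewrite /sigmoid invr_gt0 e1/= invf_lt1//; lra.
Qed.

Lemma sigmoidN u : sigmoid (- u) = 1 - sigmoid u.
Proof.
rewrite /sigmoid opprK expRN; have := expR_gt0 u => e0.
have e1 : 1 + expR u != 0 by rewrite gt_eqF//; lra.
by field; rewrite ?e1 ?(gt_eqF e0) //= addrC e1.
Qed.

Lemma logit_sigmoid u : logit (sigmoid u) = u.
Proof.
rewrite /logit -sigmoidN /sigmoid opprK expRN; have := expR_gt0 u => e0.
have e1 : 1 + expR u != 0 by rewrite gt_eqF//; lra.
rewrite -[RHS]expRK; congr ln.
by field; rewrite ?e1 ?(gt_eqF e0) //= addrC e1.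
Qed.

Lemma sigmoid_continuous : continuous sigmoid.
Proof.
move=> u; rewrite /sigmoid; apply: cvgV.
  by rewrite gt_eqF//; have := expR_gt0 (- u); lra.
apply: cvgD; first exact: cvg_cst.
apply: (@continuous_comp _ _ _ (fun u => - u) expR); last exact: continuous_expR.
exact: opp_continuous.
Qed.

Lemma sigmoid_ge_half u : (1 / 2 <= sigmoid u) = (0 <= u).
Proof.
have e0 := expR_gt0 (- u).
have e1 : 0 < 1 + expR (- u) by lra.
rewrite /sigmoid div1r lef_pV2 ?posrE// -[0 <= u]oppr_le0 -expR_le1.
by apply/idP/idP; lra.
Qed.

(** Logits and probabilities give margins of the same order; the lower bound
    follows from [expR (- h) <= (1 + h)^-1]. *)
Lemma sigmoid_margin h : 0 <= h <= 1 -> h / 8 <= sigmoid h - 1 / 2 <= h / 2.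
Proof.
move=> /andP[h0 h1]; have e0 := expR_gt0 (- h).
have eh : 1 - h <= expR (- h) by exact: expR_ge1Dx.
have eu : expR (- h) * (1 + h) <= 1.
  rewrite expRN mulrC ler_pdivrMr ?expR_gt0// mul1r; exact: expR_ge1Dx.
rewrite /sigmoid; set E := expR (- h) in e0 eh eu *.
have -> : (1 + E)^-1 - 1 / 2 = (1 - E) / (2 * (1 + E)).
  have e1 : 1 + E != 0 by rewrite gt_eqF//; lra.
  by field.
have e2 : 0 < 2 * (1 + E) by lra.
by apply/andP; split; [rewrite ler_pdivlMr|rewrite ler_pdivrMr]; nra.
Qed.

End sigmoid.

Section design_points.
Context (R : realType) (d : nat) (V : finType) (x : V -> 'I_d -> R).
Hypothesis x01 : forall v j, 0 <= x v j <= 1.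

(** The points [inr i] are there for the linear independence of the features:
    such a point and its reflection differ by a coordinate vector. *)
Definition base_point (z : V + 'I_d) (j : 'I_d) : R :=
  match z with
  | inl v => x v j
  | inr i => if j == i then 1 else 1 / 2
  end.

Definition design_point (z : (V + 'I_d) * bool) : d.-tuple R :=
  [tuple if z.2 then 1 - base_point z.1 j else base_point z.1 j | j < d].

Lemma design_point_cube z : cube (design_point z).
Proof.
case: z => [z c] j /=; rewrite tnth_mktuple /=.
have H : 0 <= base_point z j <= 1.
  by case: z => [v|i] //=; case: ifP => _; lra.
by case: c; lra.
Qed.

Lemma measurable_cube : measurable (@cube R d).
Proof.
have -> : @cube R d = \bigcap_(j in [set: 'I_d])
    ((fun y : d.-tuple R => tnth y j) @^-1` `[0, 1]).
  apply/seteqP; split=> [y h j _ /=|y h j]; first by rewrite in_itv; exact: h.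
  by have := h j I; rewrite /= in_itv.
apply: fin_bigcap_measurable => // j _.
by rewrite -[_ @^-1` _]setTI; apply: measurable_tnth => //; exact: measurable_itv.
Qed.

Context (V0 : (0 < #|V|)%N) (I0 : (0 < #|'I_d|)%N) (eps : R).
Context (eps01 : 0 <= eps <= 1).
Let w := design_pmf V0 I0 eps01.
Let PX : probability (d.-tuple R) R := finite_law w design_point.

(** A linear form that vanishes almost surely vanishes at every atom, in
    particular at the points [inr i] and at their reflections. *)
Lemma feature_law_design : 0 < eps -> feature_law PX.
Proof.
move=> eps0; split.
  rewrite /PX/= finite_lawE -[RHS](congr1 EFin (pmf_sum1 w)); congr (_%:E).
  by apply: eq_bigr => z _; rewrite indicE mem_set ?mulr1//; exact: design_point_cube.
move=> c [N [mN N0 sub]] i.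
have H b : \sum_(j < d) c j * tnth (design_point (inr i, b)) j = 0.
  apply: contrapT => nz.
  have /mem_set Nz : N (design_point (inr i, b)) by exact: sub.
  move: N0; rewrite /PX/= finite_lawE => -[] /eqP.
  rewrite psumr_eq0 => [/allP/(_ (inr i, b))|z _]; last first.
    by apply: mulr_ge0 => //; exact: (pmf_ge0 w).
  rewrite mem_index_enum => /(_ isT)/=; rewrite indicE Nz mulr1.
  move=> /eqP; rewrite /design_weight/= => wz.
  have : 0 < eps / (2 * #|'I_d|%:R) by rewrite divr_gt0// mulr_gt0// ltr0n.
  by rewrite wz ltxx.
have := congr2 (fun a b => a - b) (H false) (H true); rewrite subrr -sumrB.
under eq_bigr do rewrite !tnth_mktuple/= -mulrBr.
rewrite (bigD1 i)//= eqxx big1 => [|j ji]; last by rewrite (negbTE ji); lra.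
lra.
Qed.

(** A point and its reflection have the same mass and opposite values. *)
Lemma centred_design (g : R -> R) (j : 'I_d) :
  measurable_fun setT g -> (forall t, g (1 - t) = - g t) ->
  (\int[PX]_(y in @cube R d) (g (tnth y j))%:E = 0)%E.
Proof.
move=> mg oddg; rewrite integral_finite_law; last 2 first.
- exact: measurable_cube.
- by apply: measurable_funTS; exact: (measurableT_comp mg (measurable_tnth j)).
congr (_%:E); rewrite sum_design.
have E z b : \1_(@cube R d) (design_point (z, b)) = 1 :> R.
  by rewrite indicE mem_set//; exact: design_point_cube.
by rewrite !big1 ?addr0// => z _; rewrite !E !mul1r !tnth_mktuple/= oddg /design_weight/=; ring.
Qed.

End design_points.

Section reduction.
Context (R : realType) (n d d0 L : nat) (alpha radius : 'I_d0 -> R).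
Context (V : finType) (x : V -> 'I_d -> R) (h : R).
Context (good : pred {ffun V -> bool}).
Hypotheses (n0 : (0 < n)%N) (d0_gt0 : (0 < d0)%N) (d_gt0 : (0 < d)%N).
Hypothesis V0 : (0 < #|V|)%N.
Hypothesis x01 : forall v j, 0 <= x v j <= 1.
Hypothesis h01 : 0 <= h <= 1.
Hypothesis h_small : 4 * n%:R * h ^+ 2 <= #|V|%:R.
Hypothesis good_most :
  64 * #|[pred s | ~~ good s]|%:R <= #|{ffun V -> bool}|%:R :> R.
Hypothesis good_realizable : forall s, good s ->
  exists (J : {set 'I_d}) (e : 'I_d -> 'I_d0) (b : 'I_d -> 'I_L -> R),
    [/\ (#|J| <= d0)%N, {in J &, injective e},
        forall j, j \in J -> \sum_(l < L)
          expR (2 * alpha (e j) * l.*2.+1%:R) * b j l ^+ 2 <= radius (e j) &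
        forall v, \sum_(j in J) odd_cos_poly (b j) (x v j) =
                  if s v then h else - h].

Let I0 : (0 < #|'I_d|)%N. Proof. by rewrite card_ord. Qed.
Let eps01 := contamination01 R n0.
Let w := design_pmf V0 I0 eps01.
Let pt := design_point x.
Let delta := sigmoid h - 1 / 2.

Let logit_fun (D : {set 'I_d} * ('I_d -> 'I_L -> R)) (y : d.-tuple R) : R :=
  \sum_(j in D.1) odd_cos_poly (D.2 j) (tnth y j).

Let measurable_logit_fun D : measurable_fun setT (logit_fun D).
Proof.
have -> : logit_fun D = (fun y => \sum_(j <- enum D.1) odd_cos_poly (D.2 j) (tnth y j)).
  by apply/funext => y; rewrite big_enum.
apply: measurable_sum => j.
have mo : measurable_fun setT (odd_cos_poly (D.2 j)).
  by apply: continuous_measurable_fun; exact: odd_cos_poly_continuous.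
exact: (measurableT_comp mo (measurable_tnth j)).
Qed.

Let prob_fun D y := sigmoid (logit_fun D y).

Let measurable_prob_fun D : measurable_fun setT (prob_fun D).
Proof.
have ms : measurable_fun setT (@sigmoid R).
  by apply: continuous_measurable_fun; exact: sigmoid_continuous.
exact: (measurableT_comp ms (measurable_logit_fun D)).
Qed.

Let prob_fun01 D y : 0 <= prob_fun D y <= 1.
Proof. by have /andP[a b] := sigmoid01 (logit_fun D y); rewrite !ltW. Qed.

(** The excess risk is a sum over the design of the margin times the
    indicator of a disagreement with the Bayes classifier; the design points
    indexed by [V] give the risk bounded in [finite_lower_bound], and the
    remaining points contribute nonnegatively. *)
Lemma minimax_reduction :
  ((h / 256)%:E <= @minimax_excess_risk R d n d0 alpha radius)%E.
Proof.
have [/andP[h0 h1] /andP[dl du]] := (h01, sigmoid_margin h01).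
rewrite -/delta in dl du.
have delta01 : 0 <= delta <= 1 / 2 by lra.
have delta_small : 16 * n%:R * delta ^+ 2 <= #|V|%:R.
  apply: le_trans h_small.
  have : delta ^+ 2 <= (h / 2) ^+ 2 by rewrite ler_pXn2r ?nnegrE//; lra.
  by have : 0 <= n%:R :> R by []; nra.
pose realizes (s : {ffun V -> bool})
    (D : {set 'I_d} * ('I_d -> 'I_d0) * ('I_d -> 'I_L -> R)) := good s ->
  [/\ (#|D.1.1| <= d0)%N, {in D.1.1 &, injective D.1.2},
      forall j, j \in D.1.1 -> \sum_(l < L)
        expR (2 * alpha (D.1.2 j) * l.*2.+1%:R) * D.2 j l ^+ 2 <= radius (D.1.2 j) &
      forall v, \sum_(j in D.1.1) odd_cos_poly (D.2 j) (x v j) =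
                if s v then h else - h].
have [D HD] : {D & forall s, realizes s (D s)}.
  apply: choice => s; case: (boolP (good s)) => gs; last first.
    by exists (finset.set0, fun=> Ordinal d0_gt0, fun _ _ => 0); rewrite /realizes (negbTE gs).
  by have [J [e [b H]]] := good_realizable gs; exists (J, e, b).
pose D' s := ((D s).1.1, (D s).2).
have logit_pt s v c : good s ->
    logit_fun (D' s) (pt (inl v, c)) = if s v (+) c then h else - h.
  move=> /HD[_ _ _ H]; rewrite /logit_fun/=.
  transitivity ((-1) ^+ c * \sum_(j in (D s).1.1) odd_cos_poly ((D s).2 j) (x v j)).
    rewrite mulr_sumr; apply: eq_bigr => j _; rewrite tnth_mktuple/=.
    by case: c; rewrite ?odd_cos_poly_reflect ?mulN1r ?mul1r.
  by rewrite H; case: c; case: (s v); rewrite ?mulN1r ?mul1r ?opprK.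
(* Labellings that no logit of the class realizes still need a law of the
   labels, because Assouad's lemma averages over all of them. *)
pose p s z := if good s then prob_fun (D' s) (pt z) else
  match z.1 with
  | inl v => 1 / 2 + (if s v (+) z.2 then delta else - delta)
  | inr _ => 1 / 2
  end.
have p01 s z : 0 <= p s z <= 1.
  rewrite /p; case: ifP => _; first exact: prob_fun01.
  by case: z => -[v|i] c /=; [case: ifP => _|]; lra.
have p_inl s v c : p s (inl v, c) = 1 / 2 + (if s v (+) c then delta else - delta).
  rewrite /p; case: ifP => // gs; rewrite /prob_fun logit_pt//.
  by case: ifP => _; rewrite ?sigmoidN /delta; lra.
apply: le_ereal_inf_tmp => _ [eta meta <-].
pose eta' o v c := eta (sample pt o) (pt (inl v, c)).
have [s gs lower] := finite_lower_bound V0 I0 n0 delta01 delta_small p01 p_inl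
   eta' good_most.
pose ps := prob_fun (D' s).
have mps : measurable_fun setT ps := measurable_prob_fun (D' s).
have ps01 : forall y, 0 <= ps y <= 1 := prob_fun01 (D' s).
pose PX : probability (d.-tuple R) R := finite_law w pt.
pose q := label_pmf w (fun z => ps01 (pt z)).
pose Q : probability (d.-tuple R * bool)%type R := finite_law q (labelled_point pt).
pose Pn : probability (n.-tuple (d.-tuple R * bool)) R :=
  finite_law (prod_pmf n q) (fun o => sample pt o).
have gE : (@logit R) \o ps = logit_fun (D' s).
  by apply/funext => y; rewrite /= logit_sigmoid.
apply: (@le_trans _ _ (excess_risk Q Pn eta (logit \o ps))); last first.
  apply: ereal_sup_ubound; exists PX, ps, Q, Pn; split => //.
  - split => //; apply: feature_law_design => //.
    by rewrite invr_gt0 mulr_gt0 ?ltr0n.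
  - by move=> y _; exact: sigmoid01.
  - rewrite gE; split; first exact: Lfun_finite_law.
    exists 0, (D s).1.1, (D s).1.2, (fun j => odd_cos_poly ((D s).2 j)).
    have [HJ He Hr Hv] := HD s gs; split => //; last by move=> y _; rewrite add0r.
    move=> j /Hr jr; split; first exact: analytic_odd_cos_poly.
      exact: cos_coef_odd_cos_poly0.
    apply: centred_design => //; last exact: odd_cos_poly_reflect.
    by apply: continuous_measurable_fun; exact: odd_cos_poly_continuous.
  - by split; [exact: joint_law_finite|exact: iid_law_finite].
rewrite excess_risk_finite// gE lee_fin.
have psE z : p s z = ps (pt z) by rewrite /p gs.
have w0 z : 0 <= w z by exact: pmf_ge0.
(* [2 * delta] is the cost of one error, and [delta >= h / 8]. *)
apply: (@le_trans _ _ (2 * delta * (1 / 64))); first lra.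
apply: (@le_trans _ _ (2 * delta * \sum_o prod_weight (label_pmf w (p01 s)) o *
   \sum_v \sum_(c : bool) w (inl v, c) * (eta' o v c != s v (+) c)%:R)).
  by apply: ler_wpM2l => //; lra.
rewrite mulr_sumr; apply: ler_sum => o _; rewrite mulrCA.
have -> : prod_weight (label_pmf w (p01 s)) o = prod_weight q o.
  by apply: eq_bigr => i _; rewrite /= /label_weight psE.
apply: ler_wpM2l; first exact: prod_weight_ge0.
rewrite /finite_risk -sumrB sum_design.
have term z : 0 <= w z * (if eta (sample pt o) (pt z) then 1 - ps (pt z) else ps (pt z)) -
    w z * (if bayes (logit_fun (D' s)) (pt z) then 1 - ps (pt z) else ps (pt z)).
  rewrite -mulrBr mulr_ge0//.
  have := sigmoid_ge_half (logit_fun (D' s) (pt z)); rewrite /bayes -/(prob_fun _ _) -/ps.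
  by case: (0 <= _) => /idP; case: (eta _ _); lra.
rewrite -[leLHS]addr0; apply: lerD; last by apply: sumr_ge0 => i _; exact: addr_ge0.
rewrite mulr_sumr; apply: ler_sum => v _; rewrite big_bool mulrDr.
have inl_term c : 2 * delta * (w (inl v, c) * (eta' o v c != s v (+) c)%:R) <=
  w (inl v, c) * (if eta (sample pt o) (pt (inl v, c)) then 1 - ps (pt (inl v, c)) else ps (pt (inl v, c))) -
  w (inl v, c) * (if bayes (logit_fun (D' s)) (pt (inl v, c)) then 1 - ps (pt (inl v, c)) else ps (pt (inl v, c))).
  rewrite mulrCA -mulrBr ler_wpM2l//.
  have := p_inl s v c; rewrite psE /bayes logit_pt// /eta'.
  move=> ->; case: (s v (+) c); case: (eta _ _) => /=; rewrite ?h0 ?mulr0 ?mulr1.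
  - by lra.
  - by lra.
  - case: ifP; rewrite ?oppr_ge0 => hh; last by lra.
    by lra.
  - case: ifP; rewrite ?oppr_ge0 => hh; last by lra.
    by lra.
by apply: lerD; exact: inl_term.
Qed.

End reduction.

(** * Unknown active features *)

Lemma ord_injection (A : finType) (d : nat) : (#|A| <= d)%N ->
  exists iota : A -> 'I_d, injective iota.
Proof.
move=> Ad; exists (fun a => widen_ord Ad (enum_rank a)) => a b /(congr1 val)/= ab.
by apply: enum_rank_inj; exact: val_inj.
Qed.

Lemma odd_cos_poly_half (R : realType) L (b : 'I_L -> R) :
  odd_cos_poly b (1 / 2) = 0.
Proof.
have := odd_cos_poly_reflect b (1 / 2).
have -> : 1 - 1 / 2 = 1 / 2 :> R by lra.
lra.
Qed.

Section sparse_design.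
Context (R : realType) (n d d0 B : nat) (alpha radius : 'I_d0 -> R) (h : R).
Hypotheses (n0 : (0 < n)%N) (d0_gt0 : (0 < d0)%N).
Hypothesis dB : (d0 * 2 ^ B <= d)%N.
Hypothesis h01 : 0 <= h <= 1.
Hypothesis h_small : 4 * n%:R * h ^+ 2 <= (d0 * B.+1)%:R.
Hypothesis h_radius : forall k, expR (2 * alpha k) * h ^+ 2 <= 2 * radius k.

Let F : finType := ('I_d0 * {ffun 'I_B -> bool})%type.
Let V : finType := ('I_d0 * 'I_B.+1)%type.

(** Digit [b] of the rank of a feature in its group.  The extra digit [ord0] is
    always 1; it reads the sign of the component. *)
Let bit (b : 'I_B.+1) (f : F) : bool :=
  if unlift ord0 b is Some b' then f.2 b' else true.

(** The labelling [s] is realized by giving the component of group [k] the sign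
    [s (k, ord0)] and making active the feature whose digits are 1 exactly
    where [s] has that sign. *)
Lemma sparse_lower_bound :
  ((h / 256)%:E <= @minimax_excess_risk R d n d0 alpha radius)%E.
Proof.
have cardF : #|F| = (d0 * 2 ^ B)%N.
  by rewrite card_prod card_ffun !card_ord card_bool.
have [iota iotaI] : exists iota : F -> 'I_d, injective iota.
  by apply: ord_injection; rewrite cardF.
have d_gt0 : (0 < d)%N by apply: leq_trans dB; rewrite muln_gt0 d0_gt0 expn_gt0.
have cardV : #|V| = (d0 * B.+1)%N by rewrite card_prod !card_ord.
pose x (v : V) (j : 'I_d) : R :=
  if [pick f : F | iota f == j] is Some f then
    if f.1 == v.1 then (if bit v.2 f then 0 else 1) else 1 / 2
  else 1 / 2.
have pick_iota f : [pick g : F | iota g == iota f] = Some f.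
  by case: pickP => [g /eqP/iotaI -> //|/(_ f)]; rewrite eqxx.
have xE v f : x v (iota f) =
    if f.1 == v.1 then (if bit v.2 f then 0 else 1) else 1 / 2.
  by rewrite /x pick_iota.
apply: (@minimax_reduction R n d d0 1 alpha radius V x h predT) => //.
- by rewrite cardV muln_gt0 d0_gt0.
- move=> v j; rewrite /x; case: pickP => [f _|_]; last by lra.
  by case: ifP => _; [case: ifP => _|]; lra.
- by rewrite cardV.
- by rewrite (eq_card0 (A := [pred s | ~~ predT s])) ?mulr0.
move=> s _.
pose act (k : 'I_d0) : F := (k, [ffun b => s (k, lift ord0 b) == s (k, ord0)]).
pose e (j : 'I_d) : 'I_d0 :=
  if [pick f : F | iota f == j] is Some f then f.1 else Ordinal d0_gt0.
pose b (j : 'I_d) (l : 'I_1) : R :=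
  (if s (e j, ord0) then h else - h) / Num.sqrt 2.
have actI : injective (iota \o act) by move=> k k' /iotaI [].
have eE k : e (iota (act k)) = k by rewrite /e pick_iota.
have s2 : Num.sqrt 2 * Num.sqrt 2 = 2 :> R by rewrite -expr2 sqr_sqrtr.
have s20 : Num.sqrt 2 != 0 :> R by rewrite gt_eqF// sqrtr_gt0.
exists [set (iota \o act) k | k : 'I_d0], e, b; split.
- by rewrite card_imset// card_ord.
- by move=> _ _ /imsetP[k _ ->] /imsetP[k' _ ->]; rewrite !eE => ->.
- move=> _ /imsetP[k _ ->]; rewrite big_ord1 /b !eE mulr1.
  have -> : ((if s (k, ord0) then h else - h) / Num.sqrt 2) ^+ 2 = h ^+ 2 / 2.
    by rewrite expr_div_n sqr_sqrtr//; case: ifP; rewrite ?sqrrN.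
  by have := h_radius k; rewrite mulrA; lra.
move=> [k b0]; rewrite big_imset/=; last by move=> ? ? _ _; exact: actI.
rewrite (bigD1 k)//= big1 ?addr0 => [|k' kk']; last first.
  by rewrite xE/= (negbTE kk') odd_cos_poly_half.
have at0 : odd_cos_poly (b (iota (act k))) 0 = if s (k, ord0) then h else - h.
  by rewrite /odd_cos_poly big_ord1 /= mulr0 cos0 mulr1 /b eE divfK.
have at1 : odd_cos_poly (b (iota (act k))) 1 = - (if s (k, ord0) then h else - h).
  by rewrite -at0 -odd_cos_poly_reflect subr0.
rewrite xE/= eqxx /bit/=.
case: unliftP => [b' ->|->]; last by rewrite at0.
rewrite ffunE; case: (eqVneq (s (k, lift ord0 b')) (s (k, ord0))) => [->|]; first by rewrite at0.
by rewrite at1; case: (s _); case: (s _); rewrite ?opprK.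
Qed.

End sparse_design.

Lemma ln2_bounds (R : realType) : 1 / 2 <= ln (2 : R) <= 1.
Proof.
have e0 : 0 < expR (1 / 2) :> R by exact: expR_gt0.
have := expR_ge1Dx (- (1 / 2) : R); rewrite expRN => h.
have : expR (1 / 2) <= 2 :> R.
  have := ler_wpM2l (ltW e0) h; rewrite divff ?gt_eqF//; lra.
move=> h2; apply/andP; split; first by rewrite -[leLHS]expRK ler_ln ?posrE.
by have := @le_ln1Dx R 1; have -> : 1 + 1 = 2 :> R by []; apply; lra.
Qed.

(** With [B] the binary logarithm of [d / d0], the number [d0 (B + 1)] of
    design points is comparable to [d0 ln (d e / d0)]. *)
Lemma sparsity_lower_bound (R : realType) (alpha_max radius_min : R) :
  0 < radius_min ->
  exists2 c : R, 0 < c &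
  forall (n d d0 : nat) (alpha radius : 'I_d0 -> R),
    (1 <= d0 <= d)%N ->
    (forall k, alpha k <= alpha_max) ->
    (forall k, radius_min <= radius k) ->
    d0%:R * ln (d%:R * expR 1 / d0%:R) <= n%:R :> R ->
    ((c * Num.sqrt (d0%:R * ln (d%:R * expR 1 / d0%:R) / n%:R))%:E
     <= @minimax_excess_risk R d n d0 alpha radius)%E.
Proof.
move=> r0; pose kappa : R := Num.min (1 / 4) (radius_min / expR (2 * alpha_max)).
have k0 : 0 < kappa by rewrite lt_min (divr_gt0 r0 (expR_gt0 _)) andbT; lra.
exists (Num.sqrt (kappa / 2) / 256); first by rewrite divr_gt0 ?sqrtr_gt0//; lra.
move=> n d d0 alpha radius /andP[d01 d0d] alpha_le radius_ge hn.
have d0R : 0 < d0%:R :> R by rewrite ltr0n.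
pose m := (d %/ d0)%N; pose B := trunc_log 2 m.
have m0 : (0 < m)%N by rewrite divn_gt0.
have /andP[Bm mB] : (2 ^ B <= m < 2 ^ B.+1)%N by exact: trunc_log_bounds.
have dB : (d0 * 2 ^ B <= d)%N.
  by apply: leq_trans (leq_trunc_div d d0); rewrite mulnC leq_mul2r Bm orbT.
have dB' : (d <= d0 * 2 ^ B.+1)%N.
  apply: ltnW; apply: (@leq_trans (m.+1 * d0)); first by rewrite ltn_ceil.
  by rewrite mulnC leq_mul2l mB orbT.
have dR : 0 < d%:R :> R by rewrite ltr0n (leq_trans d01).
have lnE : ln (d%:R * expR 1 / d0%:R) = 1 + ln (d%:R / d0%:R) :> R.
  by rewrite mulrAC lnM ?posrE ?divr_gt0 ?expR_gt0// expRK addrC.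
have /andP[l2 l2'] := ln2_bounds R.
have BR : 0 <= B%:R :> R by [].
have lo : B%:R / 2 <= ln (d%:R / d0%:R) :> R.
  apply: (@le_trans _ _ (ln (2 ^+ B))); first by rewrite lnXn// -[leRHS]mulr_natl; nra.
  rewrite ler_ln ?posrE ?divr_gt0 ?exprn_gt0// ler_pdivlMr// mulrC.
  by rewrite -natrX -natrM ler_nat.
have up : ln (d%:R / d0%:R) <= B%:R + 1 :> R.
  apply: (@le_trans _ _ (ln (2 ^+ B.+1))).
    rewrite ler_ln ?posrE ?divr_gt0 ?exprn_gt0// ler_pdivrMr// mulrC.
    by rewrite -natrX -natrM ler_nat.
  by rewrite lnXn// -[leLHS]mulr_natl -natr1; nra.
rewrite lnE in hn *.
have v2 : (d0 * B.+1)%:R = d0%:R * (B%:R + 1) :> R by rewrite natrM natr1.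
have vn : (d0 * B.+1)%:R <= 2 * n%:R :> R by rewrite v2; nra.
have nR : 0 < n%:R :> R.
  have : 0 < (d0 * B.+1)%:R :> R by rewrite ltr0n muln_gt0 d01.
  by lra.
have n0 : (0 < n)%N by rewrite -(ltr0n R).
pose h := Num.sqrt (kappa * ((d0 * B.+1)%:R / n%:R)).
have vn2 : (d0 * B.+1)%:R / n%:R <= 2 :> R by rewrite ler_pdivrMr.
have vn0 : 0 <= (d0 * B.+1)%:R / n%:R :> R by rewrite divr_ge0.
have h2 : h ^+ 2 = kappa * ((d0 * B.+1)%:R / n%:R).
  by rewrite sqr_sqrtr// mulr_ge0// ltW.
have kap1 : kappa <= 1 / 4 by rewrite ge_min lexx.
have kap2 : kappa * expR (2 * alpha_max) <= radius_min.
  by rewrite -ler_pdivlMr ?expR_gt0// ge_min lexx orbT.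
have h01 : 0 <= h <= 1.
  rewrite sqrtr_ge0/= -[leRHS]sqrtr1 ler_wsqrtr//.
  by nra.
apply: (@le_trans _ _ (h / 256)%:E).
  rewrite lee_fin mulrAC ler_wpM2r// -sqrtrM ?ler_wsqrtr//; last by lra.
  have t : d0%:R * (1 + ln (d%:R / d0%:R)) / n%:R / 2 <= (d0 * B.+1)%:R / n%:R :> R.
    by rewrite mulrAC ler_wpM2r ?invr_ge0// v2; nra.
  by have := ler_wpM2l (ltW k0) t; lra.
apply: (sparse_lower_bound (B := B)) => //.
  have -> : 4 * n%:R * h ^+ 2 = 4 * kappa * (d0 * B.+1)%:R.
    by rewrite h2; field; rewrite gt_eqF.
  by rewrite -[leRHS]mul1r ler_wpM2r//; lra.
move=> k; rewrite h2.
have ea : expR (2 * alpha k) <= expR (2 * alpha_max).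
  by rewrite ler_expR; have := alpha_le k; lra.
have e0 := expR_gt0 (2 * alpha k).
have : expR (2 * alpha k) * kappa <= radius_min.
  by apply: le_trans kap2; rewrite mulrC ler_wpM2l// ltW.
by have := radius_ge k; nra.
Qed.

(** * Hadamard matrices and Rademacher sums *)

Section sylvester.
Context (R : realType) (r : nat).
Local Notation F := {ffun 'I_r -> bool}.

(** Sylvester's Hadamard matrix, the character table of an elementary abelian
    2-group. *)
Definition sylvester (a f : F) : R := \prod_i (-1) ^+ (a i && f i).

Lemma sylvester_pm1 a f : sylvester a f = 1 \/ sylvester a f = -1.
Proof.
rewrite /sylvester; elim/big_ind: _ => [|x y [->|->] [->|->]|i _]; first by left.
- by left; rewrite mulr1.
- by right; rewrite mul1r.
- by right; rewrite mulr1.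
- by left; rewrite mulrNN mulr1.
- by case: (_ && _); [right|left].
Qed.

(** The sum factors over the [r] coordinates, and a coordinate where [a] and
    [b] differ contributes the factor [1 - 1 = 0]. *)
Lemma sylvester_orthogonal (a b : F) :
  \sum_f sylvester a f * sylvester b f = (a == b)%:R * 2 ^+ r.
Proof.
under eq_bigr do rewrite -big_split/=.
rewrite -(bigA_distr_bigA (fun i y => (-1) ^+ (a i && y) * (-1) ^+ (b i && y)))/=.
have E i : \sum_(y : bool) (-1) ^+ (a i && y) * (-1) ^+ (b i && y) =
    (a i == b i)%:R * 2 :> R.
  by rewrite big_bool !andbT !andbF; case: (a i); case: (b i) => /=; ring.
under eq_bigr do rewrite E.
rewrite big_split/= prodr_const card_ord; congr (_ * _).
have [->|ab] := eqVneq a b; first by rewrite big1// => i _; rewrite eqxx.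
have [i ai] : exists i, a i != b i.
  apply/existsP; apply: contraT; rewrite negb_exists => /forallP H.
  by case/eqP: ab; apply/ffunP => i; apply/eqP; rewrite -[_ == _]negbK H.
by rewrite (bigD1 i)//= (negbTE ai) mul0r.
Qed.

End sylvester.

Section rademacher_tail.
Context (R : realType) (V : finType).
Implicit Types (c : V -> R) (s : {ffun V -> bool}).

Definition sgn_of (b : bool) : R := if b then 1 else -1.

Lemma prod_onem_ge (x : V -> R) : (forall v, 0 <= x v <= 1) ->
  1 - \sum_v x v <= \prod_v (1 - x v).
Proof.
move=> x01.
suff [] : 1 - \sum_v x v <= \prod_v (1 - x v) /\
   0 <= \prod_v (1 - x v) <= 1 /\ 0 <= \sum_v x v by [].
elim/big_rec2: _ => [|v p t _ [H [/andP[p0 p1] t0]]].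
  by split; [rewrite subr0|rewrite ler01 lexx].
have /andP[x0 x1] := x01 v.
by split; [|split]; [|apply/andP; split|]; nra.
Qed.

(** From [1 - y <= expR (- y)] one gets [expR y <= (1 - y)^-1]; adding the same
    bound for [- y] gives [2 / (1 - y ^+ 2)]. *)
Lemma cosh_le (y : R) : y ^+ 2 <= 1 / 2 ->
  (expR y + expR (- y)) * (1 - y ^+ 2) <= 2.
Proof.
move=> y2.
have y1 : -1 < y < 1 by apply/andP; split; nra.
have e0 := expR_gt0 y; have e0' := expR_gt0 (- y).
have ee : expR y * expR (- y) = 1 by rewrite -expRD subrr expR0.
have h1 : 1 + y <= expR y by exact: expR_ge1Dx.
have h2 : 1 - y <= expR (- y) by exact: expR_ge1Dx.
have u1 : expR y * (1 - y) <= 1 by rewrite -[leRHS]ee ler_pM2l.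
have u2 : expR (- y) * (1 + y) <= 1 by rewrite -[leRHS]ee [leRHS]mulrC ler_pM2l.
have : expR y * (1 - y) * (1 + y) <= 1 + y by rewrite ler_piMl//; lra.
have : expR (- y) * (1 + y) * (1 - y) <= 1 - y by rewrite ler_piMl//; lra.
lra.
Qed.

(** On average over [s] the exponential is a product of hyperbolic cosines, and
    [cosh_le] bounds it by the inverse of the product of the [1 - c v ^+ 2],
    which is at most 2 by [prod_onem_ge]. *)
Lemma rademacher_mgf c : \sum_v c v ^+ 2 <= 1 / 2 ->
  \sum_(s : {ffun V -> bool}) expR (\sum_v c v * sgn_of (s v)) <= 2 * #|{ffun V -> bool}|%:R.
Proof.
move=> c2.
have c2v v : c v ^+ 2 <= 1 / 2.
  apply: le_trans c2; rewrite (bigD1 v)//= lerDl.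
  by apply: sumr_ge0 => u _; exact: sqr_ge0.
under eq_bigr do rewrite expR_sum.
rewrite -(bigA_distr_bigA (fun v b => expR (c v * sgn_of b)))/=.
have P0 : 1 / 2 <= \prod_v (1 - c v ^+ 2).
  apply: le_trans (prod_onem_ge _); first lra.
  by move=> v; rewrite sqr_ge0/=; have := c2v v; lra.
have A : (\prod_v \sum_(b : bool) expR (c v * sgn_of b)) * \prod_v (1 - c v ^+ 2) <=
   #|{ffun V -> bool}|%:R.
  rewrite -big_split card_ffun card_bool natrX -prodr_const.
  apply: ler_prod => v _ /=; rewrite big_bool/= mulr1 mulrN1.
  rewrite (cosh_le (c2v v)) andbT mulr_ge0 ?(addr_ge0 (expR_ge0 _) (expR_ge0 _))//.
  by have := c2v v; lra.
have E0 : 0 <= \prod_v \sum_(b : bool) expR (c v * sgn_of b).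
  by apply: prodr_ge0 => v _; apply: sumr_ge0 => b _; exact: expR_ge0.
by nra.
Qed.

(** Markov's inequality for the exponential of the sum.  The tail is only
    exponential, not Gaussian, which costs a logarithm that the application
    can afford. *)
Lemma rademacher_tail c t : \sum_v c v ^+ 2 <= 1 / 2 ->
  #|[pred s : {ffun V -> bool} | t < `|\sum_v c v * sgn_of (s v)|]|%:R <=
  4 * #|{ffun V -> bool}|%:R * expR (- t).
Proof.
move=> c2.
have cN2 : \sum_v (- c v) ^+ 2 <= 1 / 2 by under eq_bigr do rewrite sqrrN.
have := lerD (rademacher_mgf c2) (rademacher_mgf cN2).
set K : R := #|_|%:R => mgf.
have -> : 4 * K * expR (- t) = (2 * K + 2 * K) * expR (- t) by ring.
apply: le_trans (ler_wpM2r (expR_ge0 _) mgf).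
rewrite -big_split/= mulr_suml -sum1_card natr_sum big_mkcond/=.
apply: ler_sum => s _; rewrite inE.
under [X in _ + expR X]eq_bigr do rewrite mulNr.
rewrite sumrN; set S := \sum_v _.
have eS := expR_ge0 S; have eN := expR_ge0 (- S); have et := expR_ge0 (- t).
case: ifP => // tS.
have [S0|S0] := leP 0 S.
  rewrite ger0_norm// in tS.
  have : 1 <= expR S * expR (- t) by rewrite -expRD -[leLHS]expR0 ler_expR subr_ge0 ltW.
  by nra.
rewrite ltr0_norm// in tS.
have : 1 <= expR (- S) * expR (- t) by rewrite -expRD -[leLHS]expR0 ler_expR subr_ge0 ltW.
by nra.
Qed.

End rademacher_tail.

(** * Richness of the analytic classes *)

Section hadamard_design.
Context (R : realType) (n d d0 r L : nat) (alpha radius : 'I_d0 -> R) (h : R).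
Hypotheses (n0 : (0 < n)%N) (L0 : (0 < L)%N).
Hypotheses (rd0 : (2 ^ r <= d0)%N) (d0d : (d0 <= d)%N).
Hypothesis h01 : 0 <= h <= 1.
Hypothesis h_small : 4 * n%:R * h ^+ 2 <= (2 ^ r * L)%:R.
Hypothesis alpha0 : forall k, 0 <= alpha k.
Let t : R := ln (2 ^+ 8 * (2 ^ r * L)%:R).
Hypothesis h_radius : forall k,
  L%:R * expR (4 * alpha k * L%:R) * (8 * h ^+ 2 * t ^+ 2 / 2 ^+ r) <= radius k.

Let F : finType := {ffun 'I_r -> bool}.
Let V : finType := (F * 'I_L)%type.
Let q : R := 2 ^+ r.
Let q0 : 0 < q. Proof. by rewrite exprn_gt0. Qed.
Let lam : R := Num.sqrt (1 / (2 * q)).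
Let lam2 : lam ^+ 2 = 1 / (2 * q).
Proof. by rewrite sqr_sqrtr// divr_ge0// mulr_ge0// ltW. Qed.
Let lam0 : 0 <= lam. Proof. exact: sqrtr_ge0. Qed.

(** Normalized so that the squares add up to 1/2, as [rademacher_tail] wants;
    the component [f] takes the value [2 h lam] times the signed sum of the
    [coord f k] at the node [k]. *)
Let coord (f : F) (k : 'I_L) (v : V) : R :=
  if v.2 == k then lam * sylvester R v.1 f else 0.

Let cardF : #|F| = (2 ^ r)%N.
Proof. by rewrite card_ffun card_bool card_ord. Qed.
Let cardV : #|V| = (2 ^ r * L)%N.
Proof. by rewrite card_prod cardF card_ord. Qed.

Let sylvester_sqr (a f : F) : sylvester R a f ^+ 2 = 1.
Proof. by have [->|->] := sylvester_pm1 R a f; rewrite ?sqrrN expr1n. Qed.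

Let sum_coord (f : F) (k : 'I_L) (G : V -> R) :
  \sum_v coord f k v * G v = lam * \sum_(a : F) sylvester R a f * G (a, k).
Proof.
rewrite sum_pair mulr_sumr; apply: eq_bigr => a _.
rewrite (bigD1 k)//= big1 ?addr0 => [|k' kk']; last by rewrite /coord/= (negbTE kk') mul0r.
by rewrite /coord/= eqxx mulrA.
Qed.

Let sum_coord_sqr f k : \sum_v coord f k v ^+ 2 <= 1 / 2.
Proof.
under eq_bigr do rewrite expr2.
rewrite sum_coord.
under eq_bigr do rewrite /coord/= eqxx mulrCA -expr2 sylvester_sqr mulr1.
rewrite sumr_const cardF -[lam *+ _]mulr_natl natrX -/q mulrCA -expr2 lam2.
by rewrite le_eqVlt; apply/orP; left; apply/eqP; field; rewrite gt_eqF.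
Qed.

Let good (s : {ffun V -> bool}) : bool :=
  [forall f, forall k, `|\sum_v coord f k v * sgn_of R (s v)| <= t].

(** Union bound over the [2 ^ r * L] signed sums; [t] is chosen so that each
    tail is at most [4 / 256] divided by their number. *)
Let good_most :
  64 * #|[pred s | ~~ good s]|%:R <= #|{ffun V -> bool}|%:R :> R.
Proof.
have vR : 0 < (2 ^ r * L)%:R :> R by rewrite ltr0n muln_gt0 expn_gt0.
have : #|[pred s | ~~ good s]|%:R <=
    \sum_f \sum_k #|[pred s : {ffun V -> bool} |
       t < `|\sum_v coord f k v * sgn_of R (s v)|]|%:R :> R.
  rewrite -sum1_card natr_sum big_mkcond/=.
  under [leRHS]eq_bigr do under eq_bigr do rewrite -sum1_card natr_sum big_mkcond/=.
  under [leRHS]eq_bigr do rewrite exchange_big/=.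
  rewrite [leRHS]exchange_big/=; apply: ler_sum => s _.
  have nn f k : 0 <= (if s \in [pred s : {ffun V -> bool} |
       t < `|\sum_v coord f k v * sgn_of R (s v)|] then 1%:R else 0) :> R by case: ifP.
  rewrite inE; case: ifP => [|_]; last first.
    by apply: sumr_ge0 => f _; apply: sumr_ge0 => k _; exact: nn.
  rewrite negb_forall => /existsP[f]; rewrite negb_forall => /existsP[k].
  rewrite -ltNge => tS; rewrite (bigD1 f)//= (bigD1 k)//= inE tS -addrA lerDl.
  apply: addr_ge0; first by apply: sumr_ge0 => k' _; exact: nn.
  by apply: sumr_ge0 => f' _; apply: sumr_ge0 => k' _; exact: nn.
set bad : R := _%:R => hbad; set K : R := #|{ffun V -> bool}|%:R.
have -> : K = 64 * ((2 ^ r * L)%:R * (4 * K * expR (- t))).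
  rewrite /t expRN lnK ?posrE ?mulr_gt0 ?exprn_gt0//.
  by move: ((2 ^ r * L)%:R : R) vR => v vR; field; rewrite gt_eqF.
rewrite ler_pM2l//; apply: (le_trans hbad).
rewrite [leRHS]mulr_natl [(2 ^ r * L)%N]mulnC mulrnA -cardF -sumr_const.
apply: ler_sum => f _; rewrite -[X in _ *+ X]card_ord -sumr_const.
by apply: ler_sum => k _; apply: rademacher_tail; exact: sum_coord_sqr.
Qed.

(** At the design point [(a, k)] the feature [f] sits at the node [k] or at
    its reflection, according to the entry [(a, f)] of the Hadamard matrix.
    Orthogonality of that matrix recovers the label of [(a, k)] from the sum of
    the components. *)
Lemma hadamard_lower_bound :
  ((h / 256)%:E <= @minimax_excess_risk R d n d0 alpha radius)%E.
Proof.
have [iota0 iota0I] : exists iota : F -> 'I_d0, injective iota.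
  by apply: ord_injection; rewrite cardF.
have d0_gt0 : (0 < d0)%N by apply: leq_trans rd0; rewrite expn_gt0.
pose iota f := widen_ord d0d (iota0 f).
have iotaI : injective iota.
  by move=> f g /(congr1 val)/= fg; apply: iota0I; exact: val_inj.
have pick_iota f : [pick g : F | iota g == iota f] = Some f.
  by case: pickP => [g /eqP/iotaI -> //|/(_ f)]; rewrite eqxx.
pose x (v : V) (j : 'I_d) : R :=
  if [pick f : F | iota f == j] is Some f then
    (if sylvester R v.1 f == 1 then dct_node R L v.2 else 1 - dct_node R L v.2)
  else 1 / 2.
have vR : 0 < (2 ^ r * L)%:R :> R by rewrite ltr0n muln_gt0 expn_gt0.
apply: (@minimax_reduction R n d d0 L alpha radius V x h good) => //.
- exact: leq_trans d0d.
- by rewrite cardV muln_gt0 expn_gt0.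
- move=> v j; rewrite /x; case: pickP => [f _|_]; last by lra.
  by have /andP[a0 a1] := dct_node_itv R L0 (ltn_ord v.2); case: ifP => _; lra.
- by rewrite cardV.
move=> s /forallP gs.
pose S f k := \sum_v coord f k v * sgn_of R (s v).
pose u f k := 2 * h * lam * S f k.
have t0 : 0 <= t.
  have v1 : 1 <= (2 ^ r * L)%:R :> R by rewrite ler1n muln_gt0 expn_gt0.
  by rewrite ln_ge0// -[leLHS]mulr1 ler_pM// exprn_ege1//; lra.
have /andP[h0 h1] := h01.
have uM f k : `|u f k| <= 2 * h * lam * t.
  rewrite /u normrM ger0_norm ?mulr_ge0// ler_wpM2l ?mulr_ge0//.
  by have /forallP := gs f; exact.
pose interpolates (f : F) (c : 'I_L -> R) :=
  (forall k : 'I_L, odd_cos_poly c (dct_node R L k) = u f k) /\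
  (forall l, `|c l| <= 2 * (2 * h * lam * t)).
have [b Hb] : {b & forall f, interpolates f (b f)}.
  by apply: choice => f; apply: odd_cos_poly_interpolation => // k; exact: uM.
pose pk (j : 'I_d) : F := odflt [ffun=> true] [pick f : F | iota f == j].
have pkE f : pk (iota f) = f by rewrite /pk pick_iota.
exists [set iota f | f : F], (fun j => iota0 (pk j)), (fun j => b (pk j)); split.
- by rewrite card_imset// cardF.
- by move=> _ _ /imsetP[f _ ->] /imsetP[g _ ->]; rewrite !pkE => /iota0I ->.
- move=> _ /imsetP[f _ ->]; rewrite pkE; apply: le_trans (h_radius _).
  set al := alpha _; have al0 : 0 <= al by exact: alpha0.
  rewrite -mulrA; set E := (X in _ <= L%:R * X).
  have -> : L%:R * E = \sum_(l < L) E by rewrite sumr_const card_ord mulr_natl.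
  apply: ler_sum => l _; rewrite /E.
  apply: ler_pM; rewrite ?expR_ge0 ?sqr_ge0//.
    rewrite ler_expR.
    have : (l.*2.+1%:R : R) <= 2 * L%:R.
      by rewrite -natrM ler_nat; have := ltn_ord l; lia.
    by nra.
  have -> : 8 * h ^+ 2 * t ^+ 2 / 2 ^+ r = (2 * (2 * h * lam * t)) ^+ 2.
    have -> : (2 * (2 * h * lam * t)) ^+ 2 = 16 * h ^+ 2 * t ^+ 2 * lam ^+ 2 by ring.
    by rewrite lam2 -/q; field; rewrite gt_eqF.
  rewrite -[leLHS]real_normK ?num_real// ler_pXn2r ?nnegrE ?mulr_ge0//.
  exact: (Hb f).2.
move=> [a k]; rewrite big_imset/=; last by move=> ? ? _ _; exact: iotaI.
transitivity (\sum_(f : F) sylvester R a f * u f k).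
  apply: eq_bigr => f _; rewrite pkE /x pick_iota/= -(Hb f).1.
  have [->|->] := sylvester_pm1 R a f; first by rewrite eqxx mul1r.
  by rewrite -[_ == 1]negbK eqNr oner_eq0/= odd_cos_poly_reflect mulN1r.
have uE f : u f k = h / q * \sum_(a' : F) sylvester R a' f * sgn_of R (s (a', k)).
  rewrite /u /S (sum_coord f k (fun v => sgn_of R (s v))) mulrA; congr (_ * _).
  have -> : 2 * h * lam * lam = 2 * h * lam ^+ 2 by ring.
  by rewrite lam2; field; rewrite gt_eqF.
under eq_bigr do rewrite uE mulrCA mulr_sumr.
rewrite -mulr_sumr exchange_big/=.
under eq_bigr do under eq_bigr do rewrite mulrA.
under eq_bigr do rewrite -mulr_suml sylvester_orthogonal.
rewrite (bigD1 a)//= eqxx big1 => [|a' aa']; last by rewrite eq_sym (negbTE aa') !mul0r.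
rewrite mul1r addr0 -/q mulrA divfK ?gt_eqF//.
by rewrite /sgn_of; case: (s _); rewrite ?mulr1 ?mulrN1.
Qed.

End hadamard_design.

(** Take [q = 2 ^ r] between [d0 / 2] and [d0], and [L] of order [ln n], so
    that [q L] is comparable to the sum of the [1 / alpha] times [ln n].  The
    squared coefficients are of order [h ^+ 2 / q], that is [L / n] up to
    logarithms, and [L] is small enough for [expR (4 alpha L)] to stay below
    [sqrt n]; the class therefore contains these components. *)
Lemma smoothness_lower_bound (R : realType) (alpha_min alpha_max radius_min M : R) :
  0 < alpha_min -> 0 < radius_min ->
  exists c n1 : R, [/\ 0 < c, 0 < n1 &
  forall (n d d0 : nat) (alpha radius : 'I_d0 -> R),
    (1 <= d0 <= d)%N ->
    (forall k, alpha_min <= alpha k <= alpha_max) ->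
    (forall k, radius_min <= radius k) ->
    (\sum_(k < d0) (alpha k)^-1) * ln n%:R <= M * n%:R ->
    n1 <= ln n%:R ->
    ((c * Num.sqrt ((\sum_(k < d0) (alpha k)^-1) * (ln n%:R / n%:R)))%:E
     <= @minimax_excess_risk R d n d0 alpha radius)%E].
Proof.
move=> am0 r0.
(* With [L <= ln n / D], the term [8 * alpha_max] gives
   [expR (4 * alpha * L) <= expR (ln n / 2)], and the term with [M] gives
   [q * L <= n], hence [h <= 1]. *)
pose D : R := 1 + 8 * `|alpha_max| + `|M| * `|alpha_max|.
have DM : 0 <= `|M| * `|alpha_max| by rewrite mulr_ge0.
have Da : 0 <= `|alpha_max| by [].
have D1 : 1 <= D by rewrite /D; lra.
pose c0 : R := D^-1.
have c00 : 0 < c0 by rewrite invr_gt0; lra.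
have cD : c0 * D = 1 by rewrite mulVf// gt_eqF//; lra.
pose E4 : R := expR 4.
have E40 : 0 < E4 by exact: expR_gt0.
pose kappa : R := Num.min (1 / 4) (radius_min / (8 * 8 ^+ 4 * E4)).
have k0 : 0 < kappa.
  by rewrite lt_min (divr_gt0 r0) ?andbT ?mulr_gt0 ?exprn_gt0//; lra.
have kap1 : kappa <= 1 / 4 by rewrite ge_min lexx.
have kap2 : kappa * (8 * 8 ^+ 4 * E4) <= radius_min.
  by rewrite -ler_pdivlMr ?mulr_gt0 ?exprn_gt0// ge_min lexx orbT.
pose C2 := kappa * c0 * alpha_min / 4.
have C20 : 0 < C2 by rewrite divr_gt0 ?mulr_gt0.
exists (Num.sqrt C2 / 256), D; split; [by rewrite divr_gt0 ?sqrtr_gt0|by lra|].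
move=> n d d0 alpha radius /andP[d01 d0d] alphaP radius_ge hM hn.
set ell : R := ln n%:R in hM hn *.
have ell1 : 1 <= ell by lra.
have nR : 0 < n%:R :> R.
  rewrite ltr0n lt0n; apply/negP => /eqP n00.
  by move: ell1; rewrite /ell n00 ln0//; lra.
have n0 : (0 < n)%N by rewrite -(ltr0n R).
have d0R : 0 < d0%:R :> R by rewrite ltr0n.
have a0 k : 0 < alpha k by have /andP[a1 _] := alphaP k; lra.
have amax0 : 0 < alpha_max.
  have /andP[a1 a2] := alphaP (Ordinal d01); lra.
have amaxE : `|alpha_max| = alpha_max by rewrite gtr0_norm.
pose r := trunc_log 2 d0.
have /andP[rd0 d0r] : (2 ^ r <= d0 < 2 ^ r.+1)%N by exact: trunc_log_bounds.
pose L := Num.truncn (c0 * ell).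
have cl1 : 1 <= c0 * ell by rewrite -cD ler_pM2l.
have /andP[L1 L2] : L%:R <= c0 * ell < L.+1%:R.
  by apply: truncn_itv; lra.
have L0 : (0 < L)%N.
  by rewrite lt0n; apply/negP => /eqP L00; move: L2; rewrite L00; lra.
have LR1 : 1 <= L%:R :> R by rewrite ler1n.
have LR2 : c0 * ell / 2 <= L%:R.
  by move: L2; rewrite -natr1; lra.
pose q : R := 2 ^+ r.
have qE : (2 ^ r)%:R = q by rewrite natrX.
have q0 : 0 < q by rewrite exprn_gt0.
have qd0 : q <= d0%:R by rewrite -qE ler_nat.
have d0q : d0%:R <= 2 * q.
  by rewrite -qE -natrM -expnS ler_nat ltnW.
have vE : (2 ^ r * L)%:R = q * L%:R :> R by rewrite natrM qE.
have sum_lo : d0%:R / alpha_max <= \sum_(k < d0) (alpha k)^-1.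
  rewrite -[d0 in d0%:R]card_ord mulr_natl -sumr_const; apply: ler_sum => k _.
  by rewrite lef_pV2 ?posrE//; have /andP[] := alphaP k.
have sum_up : \sum_(k < d0) (alpha k)^-1 <= d0%:R / alpha_min.
  rewrite -[d0 in d0%:R]card_ord mulr_natl -sumr_const; apply: ler_sum => k _.
  by rewrite lef_pV2 ?posrE//; have /andP[] := alphaP k.
have vn : q * L%:R <= n%:R.
  have s1 : d0%:R / alpha_max * ell <= M * n%:R.
    by apply: le_trans hM; rewrite ler_wpM2r//; lra.
  have s2 : d0%:R * ell <= alpha_max * (M * n%:R).
    rewrite mulrC -ler_pdivrMl//; apply: le_trans s1.
    by rewrite le_eqVlt; apply/orP; left; apply/eqP; field; rewrite gt_eqF.
  have Mn : M * n%:R <= `|M| * n%:R by rewrite ler_wpM2r// ler_norm.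
  have s3 : d0%:R * ell <= D * n%:R.
    apply: (le_trans s2); apply: (@le_trans _ _ (alpha_max * (`|M| * n%:R))).
      by rewrite ler_wpM2l// ltW.
    by rewrite mulrA [alpha_max * _]mulrC ler_wpM2r// /D amaxE; lra.
  apply: (@le_trans _ _ (d0%:R * (c0 * ell))).
    by apply: ler_pM => //; lra.
  rewrite mulrCA; have := ler_wpM2l (ltW c00) s3.
  by rewrite [c0 * (D * _)]mulrA cD mul1r.
pose h := Num.sqrt (kappa * (q * L%:R / n%:R)).
have vn1 : q * L%:R / n%:R <= 1 by rewrite ler_pdivrMr// mul1r.
have vn0 : 0 <= q * L%:R / n%:R by rewrite divr_ge0// mulr_ge0// ltW.
have h2 : h ^+ 2 = kappa * (q * L%:R / n%:R).
  by rewrite sqr_sqrtr// mulr_ge0// ltW.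
have h01 : 0 <= h <= 1.
  rewrite sqrtr_ge0/= -[leRHS]sqrtr1 ler_wsqrtr//.
  by nra.
apply: (@le_trans _ _ (h / 256)%:E).
  rewrite lee_fin mulrAC ler_wpM2r// -sqrtrM ?ler_wsqrtr//; last exact: ltW.
  have el0 : 0 <= ell / n%:R by rewrite divr_ge0//; lra.
  have t1 : (\sum_(k < d0) (alpha k)^-1) * (ell / n%:R) <=
      d0%:R / alpha_min * (ell / n%:R) by rewrite ler_wpM2r.
  apply: (le_trans (ler_wpM2l (ltW C20) t1)).
  have -> : C2 * (d0%:R / alpha_min * (ell / n%:R)) =
     kappa * (d0%:R / 2 * (c0 * ell / 2) / n%:R).
    by rewrite /C2; field; rewrite !gt_eqF.
  rewrite ler_wpM2l ?(ltW k0)// ler_wpM2r ?invr_ge0//.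
  apply: ler_pM; rewrite ?divr_ge0 ?mulr_ge0//; lra.
apply: (hadamard_lower_bound (r := r) (L := L)) => //.
- rewrite vE; have -> : 4 * n%:R * h ^+ 2 = 4 * kappa * (q * L%:R).
    by rewrite h2; field; rewrite gt_eqF.
  by rewrite -[leRHS]mul1r ler_wpM2r ?mulr_ge0 ?(ltW q0)//; lra.
- by move=> k; exact: ltW.
move=> k; rewrite vE h2 -/q; apply: le_trans (radius_ge k).
set t := ln _.
have v0 : 0 < q * L%:R by rewrite mulr_gt0//; lra.
have tE : 0 <= t <= 8 + ell.
  have /andP[l2 l2'] := ln2_bounds R.
  apply/andP; split.
    have q1 : 1 <= q by rewrite exprn_ege1//; lra.
    rewrite ln_ge0// -[leLHS]mulr1 ler_pM//; first by rewrite exprn_ege1//; lra.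
    by rewrite -[leLHS]mulr1 ler_pM//; lra.
  have -> : 8 + ell = 8 + ln n%:R by [].
  rewrite /t lnM ?posrE ?exprn_gt0//; apply: lerD; last by rewrite ler_ln ?posrE.
  by rewrite lnXn// -[leLHS]mulr_natl; lra.
have -> : L%:R * expR (4 * alpha k * L%:R) *
   (8 * (kappa * (q * L%:R / n%:R)) * t ^+ 2 / q) =
   8 * kappa * (L%:R ^+ 2 * t ^+ 2 * (expR (4 * alpha k * L%:R) / n%:R)).
  by field; rewrite !gt_eqF.
have nE : n%:R = expR ell by rewrite /ell lnK.
have b1 : expR (4 * alpha k * L%:R) / n%:R <= expR (- (ell / 2)).
  rewrite nE -expRN -expRD ler_expR.
  have /andP[_ ak] := alphaP k; have := a0 k => ak0.
  have : alpha k * L%:R <= alpha_max * (c0 * ell) by apply: ler_pM => //; lra.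
  have : 8 * alpha_max * c0 <= 1.
    rewrite -[leRHS]cD [leRHS]mulrC ler_wpM2r ?(ltW c00)// /D amaxE.
    by rewrite amaxE in DM; lra.
  by nra.
have b2 : L%:R ^+ 2 * t ^+ 2 <= (8 + ell) ^+ 4.
  have -> : (8 + ell) ^+ 4 = (8 + ell) ^+ 2 * (8 + ell) ^+ 2 by rewrite -exprD.
  have /andP[t0 t8] := tE.
  have c1 : c0 <= 1 by rewrite invf_le1//; lra.
  have Le : L%:R <= 8 + ell by nra.
  by apply: ler_pM; rewrite ?sqr_ge0// ler_pXn2r ?nnegrE//; lra.
(* A power of [ell] against an exponential, by [u <= expR u] at
   [u = (8 + ell) / 8]; this is where [8 ^+ 4 * expR 4] comes from. *)
have b3 : (8 + ell) ^+ 4 * expR (- (ell / 2)) <= 8 ^+ 4 * E4.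
  have : ((8 + ell) / 8) ^+ 4 <= expR ((8 + ell) / 8) ^+ 4.
    rewrite ler_pXn2r ?nnegrE ?expR_ge0 ?divr_ge0//; [|lra].
    by apply: le_trans (expR_ge1Dx _); lra.
  rewrite -expRM_natl => H.
  have -> : expR (- (ell / 2)) = E4 / expR (4 * ((8 + ell) / 8)).
    by rewrite -expRN -expRD; congr expR; field.
  rewrite mulrA ler_pdivrMr ?expR_gt0//.
  have -> : (8 + ell) ^+ 4 * E4 = 8 ^+ 4 * E4 * ((8 + ell) / 8) ^+ 4 by field.
  by rewrite ler_wpM2l// mulr_ge0// ltW.
have b4 : L%:R ^+ 2 * t ^+ 2 * (expR (4 * alpha k * L%:R) / n%:R) <= 8 ^+ 4 * E4.
  apply: le_trans b3.
  apply: ler_pM; rewrite ?divr_ge0 ?mulr_ge0 ?sqr_ge0 ?expR_ge0//; by case/andP: tE.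
apply: le_trans kap2.
have := ler_wpM2l (ltW k0) b4; lra.
Qed.

(** * The minimax lower bound *)

Lemma sqrt_le_scaled (R : realType) (m A X : R) :
  0 <= m -> 0 <= A -> X <= m ^+ 2 * A -> Num.sqrt X <= m * Num.sqrt A.
Proof.
move=> m0 A0 XA; rewrite -[X in X * _]ger0_norm// -sqrtr_sqr -sqrtrM ?sqr_ge0//.
exact: ler_wsqrtr.
Qed.

Unset Implicit Arguments.

Theorem theorem3p5 (R : realType) (alpha_min alpha_max radius_min M : R)
    (halpha : 0 < alpha_min) (hradius : 0 < radius_min) :
  exists C : R, 0 < C /\
  forall (n d d0 : nat) (alpha radius : 'I_d0 -> R),
    (1 <= d0 <= d)%N ->
    (forall k, alpha_min <= alpha k <= alpha_max) ->
    (forall k, radius_min <= radius k) ->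
    (\sum_(k < d0) (alpha k)^-1) * ln n%:R <= M * n%:R ->
    d0%:R * ln (d%:R * expR 1 / d0%:R) <= n%:R :> R ->
    ((C * Num.sqrt (d0%:R * ln (d%:R * expR 1 / d0%:R) / n%:R
                    + (\sum_(k < d0) (alpha k)^-1) * (ln n%:R / n%:R)))%:E
     <= @minimax_excess_risk R d n d0 alpha radius)%E.
Proof.
have [c1 c10 sparsity] := sparsity_lower_bound alpha_max hradius.
have [c2 [n1 [c20 n10 smoothness]]] :=
  smoothness_lower_bound alpha_max M halpha hradius.
(* When [ln n < n1], the smoothness term is at most [K - 1] times the sparsity
   term, which is at least [d0 / n]. *)
pose K := 1 + n1 / alpha_min.
have K1 : 1 <= K by rewrite lerDl divr_ge0// ltW.
pose C := Num.min (Num.min (c1 / 2) (c2 / 2)) (c1 / K).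
have C0 : 0 < C by rewrite !lt_min !divr_gt0//; lra.
have [C1 C2 C3] : [/\ C * 2 <= c1, C * 2 <= c2 & C * K <= c1].
  have K0 : 0 < K by lra.
  by split; rewrite -ler_pdivlMr// !ge_min lexx ?orbT.
exists C; split => // n d d0 alpha radius hd halphak hrad hM hn.
have Hsp := sparsity n d d0 alpha radius hd (fun k => proj2 (andP (halphak k))) hrad hn.
have Hsm := smoothness n d d0 alpha radius hd halphak hrad hM.
set A := d0%:R * _ / _ in Hsp *; set B := _ * (_ / _) in Hsm *.
have /andP[d01 d0d] := hd.
have d0R : 0 < d0%:R :> R by rewrite ltr0n.
have lnd : 1 <= ln (d%:R * expR 1 / d0%:R) :> R.
  rewrite -[leLHS]expRK ler_ln ?posrE ?expR_gt0 ?divr_gt0 ?mulr_gt0 ?ltr0n ?(leq_trans d01)//.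
  by rewrite ler_pdivlMr// mulrC ler_wpM2r ?expR_ge0// ler_nat.
have nR : 0 <= n%:R :> R by [].
have A0 : 0 <= A by rewrite divr_ge0// mulr_ge0//; lra.
have bound c m X : 0 <= m -> C * m <= c -> 0 <= X -> A + B <= m ^+ 2 * X ->
    ((c * Num.sqrt X)%:E <= @minimax_excess_risk R d n d0 alpha radius)%E ->
    ((C * Num.sqrt (A + B))%:E <= @minimax_excess_risk R d n d0 alpha radius)%E.
  move=> m0 Cm X0 AB; apply: le_trans; rewrite lee_fin.
  apply: (@le_trans _ _ (C * (m * Num.sqrt X))).
    by rewrite ler_wpM2l ?(ltW C0)// sqrt_le_scaled.
  by rewrite mulrA ler_wpM2r// sqrtr_ge0.
have [n1n|n1n] := leP n1 (ln n%:R).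
  have [BA|AB] := leP B A.
    by apply: (bound c1 2 A) => //; lra.
  by apply: (bound c2 2 B) => //; [lra|lra|exact: Hsm].
apply: (bound c1 K A) => //; first lra.
have ai0 k : 0 <= (alpha k)^-1.
  by have /andP[a1 _] := halphak k; rewrite invr_ge0; lra.
have sum_up : \sum_(k < d0) (alpha k)^-1 <= d0%:R / alpha_min.
  have -> : d0%:R / alpha_min = \sum_(k < d0) alpha_min^-1.
    by rewrite sumr_const card_ord mulr_natl.
  apply: ler_sum => k _; have /andP[a1 _] := halphak k.
  by rewrite lef_pV2 ?posrE//; lra.
have BA : B <= n1 / alpha_min * A.
  apply: (@le_trans _ _ (d0%:R / alpha_min * (n1 / n%:R))).
    apply: (@le_trans _ _ ((\sum_(k < d0) (alpha k)^-1) * (n1 / n%:R))).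
      by rewrite ler_wpM2l ?sumr_ge0// ler_wpM2r ?invr_ge0// ltW.
    by rewrite ler_wpM2r// divr_ge0// ltW.
  rewrite /A; set l := ln _ in lnd *.
  have -> : n1 / alpha_min * (d0%:R * l / n%:R) = d0%:R / alpha_min * (n1 / n%:R) * l.
    by ring.
  rewrite ler_peMr// !mulr_ge0// ?invr_ge0// ltW//.
apply: (@le_trans _ _ (K * A)); first by rewrite /K mulrDl mul1r lerD2l.
by rewrite ler_wpM2r// expr2 ler_peMr//; lra.
Qed.
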